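(* Let $G$ be a $3$-connected graph. Then $G$ has a subgraph $F$ such that $V(F)=V(G)$ and each block of $F$ is an inner fan of $G$ or is induced by a contractible edge of $G$.
   Context: Graphs are allowed to have loops and parallel edges; $|G|$ is the number of vertices of $G$. A graph is $k$-connected if the removal of each set of fewer than $k$ vertices leaves a connected graph (the usual requirement that $|G|>k$ is not imposed). For $X\subseteq E(G)$, $G[X]$ is the subgraph of $G$ induced by $X$ (edge set $X$, vertices the endvertices of edges of $X$); $G/X$ is the contraction of $X$, and $G/F:=G/E(F)$ for a subgraph $F$. An edge $e$ of a $3$-connected graph $G$ is contractible if $G/e$ is $3$-connected. A block of a graph is a maximal connected subgraph without a cut vertex of its own. A wye of $G$ is a subgraph of $G$ isomorphic to the star with $3$ edges. A fan of $G$ is a simple subgraph $F$ of $G$ with at least $3$ edges such that $E(F)$ has an ordering $a_0,a_1,\dots,a_{m+1}$ of its distinct edges (a fan ordering) such that for $i=1,\dots,m$ the set $\{a_{i-1},a_i,a_{i+1}\}$ induces a wye or a triangle in $G$, and for $0<i<m$, $\{a_{i-1},a_i,a_{i+1}\}$ induces a wye in $G$ if and only if $\{a_i,a_{i+1},a_{i+2}\}$ induces a triangle. A fan is wye-to-wye if it begins and ends with wyes, that is, it has a fan ordering $x_0,y_1,x_1,\dots,y_n,x_n$ where $y_i=uv_i$ for $1\le i\le n$, $x_i=v_iv_{i+1}$ for $0\le i\le n$, and $u,v_0,\dots,v_{n+1}$ are pairwise distinct except that possibly $v_0=v_{n+1}$. A wye-to-wye fan is maximal if it is not a proper subgraph of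 another wye-to-wye fan of $G$. If $F^+$ is a maximal wye-to-wye fan of $G$ with fan ordering $x_0,y_1,x_1,\dots,y_n,x_n$, then $F:=G[\{y_1,x_1,\dots,x_{n-1},y_n\}]$ is an inner fan of $G$ provided $G/F$ is $3$-connected (this includes the case in which $F$ has a single edge).
   Formalization: A wye is required to have a centre with exactly three neighbours in G (for arbitrary three-edge stars the claim is false), and G is assumed to have at least one edge, which excludes only the edgeless one-vertex graph and the null graph, where the claim fails. *)

(* Defs.v *)
From HB Require Import structures.
From mathcomp Require Import all_boot.

Set Implicit Arguments.
Unset Strict Implicit.
Unset Printing Implicit Defensive.

(* Finite graphs with loops (edges with one end) and parallel edges. *)
Record mgraph := MGraph {
  vert : finType;
  edge : finType;
  ends : edge -> {set vert};
  ends_card : forall e, 0 < #|ends e| <= 2 }.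

Record subgraph (G : mgraph) := Subgraph {
  sV : {set vert G};
  sE : {set edge G};
  _ : [forall e in sE, ends e \subset sV] }.

Section Graph.

Variable G : mgraph.
Implicit Types (H K B F : subgraph G) (S : {set vert G}) (X : {set edge G}).
Implicit Types (x y c p q r u : vert G) (e f g : edge G).

Definition sub_le H K : bool := (sV H \subset sV K) && (sE H \subset sE K).

Fact whole_subproof : [forall e in [set: edge G], ends e \subset [set: vert G]].
Proof. by apply/forall_inP => e _; apply: subsetT. Qed.

Definition whole : subgraph G := Subgraph whole_subproof.

Fact del_subproof H S :
  [forall e in [set e in sE H | [disjoint ends e & S]], ends e \subset sV H :\: S].
Proof.
apply/forall_inP => e; rewrite inE => /andP[eH eS].
rewrite subsetD eS andbT; case: H eH => V E /= /forall_inP; exact.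
Qed.

(* H - S *)
Definition del H S : subgraph G := Subgraph (del_subproof H S).

Fact induced_subproof X :
  [forall e in X, ends e \subset \bigcup_(f in X) ends f].
Proof. by apply/forall_inP => e eX; apply: bigcup_sup eX. Qed.

(* G[X] *)
Definition induced X : subgraph G := Subgraph (induced_subproof X).

Definition adj X x y : bool := [exists e in X, ends e == [set x; y]].

(* The null graph counts as connected: without this convention no graph on
   fewer than three vertices would be 3-connected in the sense below, although
   the condition |G| > k is meant not to be imposed. *)
Definition connected H : bool :=
  [forall x in sV H, forall y in sV H, connect (adj (sE H)) x y].

Definition k_connected (k : nat) : Prop :=
  forall S, #|S| < k -> connected (del whole S).

(* Meaningful for connected H. *)
Definition cut_vertex H x : bool :=
  (x \in sV H) && ~~ connected (del H [set x]).

Definition nonseparable H : Prop := connected H /\ forall x, ~~ cut_vertex H x.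

Definition block F B : Prop :=
  [/\ sub_le B F, nonseparable B &
      forall K, sub_le K F -> nonseparable K -> sub_le B K -> K = B].

(* The vertices of G/X are the vertex sets of the components of (V(G), X). *)
Definition component X x : {set vert G} := [set y | connect (adj X) x y].

Definition contract_vert X : finType :=
  {C : {set vert G} | C \in [set component X x | x : vert G]}.

Fact contract_proj_subproof X x :
  component X x \in [set component X y | y : vert G].
Proof. exact: imset_f. Qed.

Definition contract_proj X x : contract_vert X :=
  exist _ (component X x) (contract_proj_subproof X x).

Definition contract_edge X : finType := {e : edge G | e \notin X}.

Definition contract_ends X (e : contract_edge X) : {set contract_vert X} :=
  [set contract_proj X x | x in ends (val e)].

Fact contract_ends_card X (e : contract_edge X) :
  0 < #|contract_ends e| <= 2.
Proof.
have /andP[e0 e2] := ends_card (val e).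
rewrite (leq_trans (leq_imset_card _ _) e2) andbT.
have [x xe] := card_gt0P e0.
by apply/card_gt0P; exists (contract_proj X x); apply: imset_f.
Qed.

Definition contract X : mgraph := MGraph (@contract_ends_card X).

Definition neighbours x : {set vert G} :=
  [set y | (y != x) && adj [set: edge G] x y].

(* A star with three edges whose centre has no further neighbour in G.  For a
   simple graph G this says that the centre has degree 3, which is what forces
   v_0, ..., v_{n+1} to be distinct (except possibly v_0 = v_{n+1}) in a fan
   that begins and ends with wyes.  Counting neighbours rather than edges makes
   the notion insensitive to loops and parallel edges. *)
Definition is_wye H : Prop :=
  exists c p q r e f g,
    [/\ uniq [:: c; p; q; r],
        sV H = [set c; p; q; r],
        sE H = [set e; f; g],
        [/\ ends e = [set c; p], ends f = [set c; q] & ends g = [set c; r]] &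
        neighbours c = [set p; q; r]].

Definition is_triangle H : Prop :=
  exists p q r e f g,
    [/\ uniq [:: p; q; r],
        sV H = [set p; q; r],
        sE H = [set e; f; g] &
        [/\ ends e = [set p; q], ends f = [set q; r] & ends g = [set p; r]]].

Definition simple H : Prop :=
  {in sE H, forall e, #|ends e| = 2} /\ {in sE H &, injective (@ends G)}.

(* The subgraph induced by a_{i-1}, a_i, a_{i+1}. *)
Definition triple (a : nat -> edge G) (i : nat) : subgraph G :=
  induced [set a i.-1; a i; a i.+1].

(* The edges of F are listed as a_0, ..., a_{m+1}; the values of a beyond
   m + 1 are irrelevant. *)
Definition fan_ordering F (m : nat) (a : nat -> edge G) : Prop :=
  [/\ 0 < m,
      simple F,
      F = induced [set a i | i : 'I_m.+2],
      (forall i j, i < m.+2 -> j < m.+2 -> a i = a j -> i = j) &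
      (forall i, 0 < i <= m -> is_wye (triple a i) \/ is_triangle (triple a i))
      /\
      (forall i, 0 < i < m -> is_wye (triple a i) <-> is_triangle (triple a i.+1))].

(* With x_i := a_{2i} and y_i := a_{2i-1}, the sequence a_0, ..., a_{2n} is
   x_0, y_1, x_1, ..., y_n, x_n. *)
Definition wye_to_wye_ordering F (n : nat) (a : nat -> edge G) : Prop :=
  [/\ 0 < n,
      fan_ordering F n.*2.-1 a &
      exists (u : vert G) (v : nat -> vert G),
        [/\ forall i, 0 < i <= n -> ends (a i.*2.-1) = [set u; v i],
            forall i, i <= n -> ends (a i.*2) = [set v i; v i.+1],
            forall i, i <= n.+1 -> u != v i &
            forall i j, i < j <= n.+1 -> v i = v j -> i = 0 /\ j = n.+1]].

Definition wye_to_wye_fan F : Prop := exists n a, wye_to_wye_ordering F n a.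

Definition maximal_wye_to_wye_fan F : Prop :=
  wye_to_wye_fan F /\
  forall K, wye_to_wye_fan K -> sub_le F K -> K = F.

End Graph.

(* The edges a_1, ..., a_{2n-1} are y_1, x_1, ..., x_{n-1}, y_n. *)
Definition inner_fan (G : mgraph) (F : subgraph G) : Prop :=
  exists (Fp : subgraph G) (n : nat) (a : nat -> edge G),
    [/\ maximal_wye_to_wye_fan Fp,
        wye_to_wye_ordering Fp n a,
        F = induced [set a i.+1 | i : 'I_n.*2.-1] &
        k_connected (contract (sE F)) 3].

Definition contractible (G : mgraph) (e : edge G) : Prop :=
  k_connected (contract [set e]) 3.

(* Main.v *)
Require Import Defs.
From mathcomp Require Import all_boot.
From mathcomp Require Import zify.

(* Every vertex on a contractible edge that is not a loop can be covered by a
   minimal set of contractible edges, each of which then has a private end.  So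
   let u be a vertex on no such edge.  In the 2-connected graph H = G - u every
   neighbour w of u lies in a 2-separator, so an uncrossing argument shows that
   each side of each 2-separator of H contains a vertex of degree 2 of H, i.e. a
   neighbour of u of degree 3 in G.  The maximal paths of such vertices are the
   rims of fans with hub u.  If contracting the fan on a rim destroys
   3-connectivity, then a vertex t separates the two ends of the rim in H minus
   the rim; choosing the rim, t and a side A of this separation with |A| minimal,
   another rim inside A gives a smaller side.  Hence some fan with hub u is inner.
   Its rim edges are contractible, which makes the fans chosen for different
   hubs disjoint. *)

(** Separations are treated for a symmetric irreflexive neighbourhood function on a finite type, so
    loops and parallel edges disappear, and H is never formed: a 2-separator of H is a 3-separator
    of G through u. After contracting a connected set of edges with vertex set U, a small separator
    must contain the new vertex, hence comes from a separator t + U of G; this is why one extra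
    vertex t appears both for edges and for fans. A rim is taken maximal because its ends, when
    distinct, then lie outside the degree-3 neighbours of u: each has a neighbour besides u and any
    two prescribed vertices, and no other rim runs through it. A closed rim is harmless, since by
    3-connectivity it leaves only the hub and one more vertex. The descent needs t to have two
    neighbours in A; if it has only one, t is moved to that neighbour, which shrinks A. In the final
    subgraph every covering edge has an end of degree 1, and this determines the blocks. *)

Set Implicit Arguments.
Unset Strict Implicit.
Unset Printing Implicit Defensive.

(* Proves goals about membership by splitting boolean hypotheses and
   substituting equations, until two of them clash. *)
Ltac bsplit1 := match goal with
  | H : is_true ?a, H' : is_true (~~ ?a) |- _ => by rewrite H in H'
  | H : is_true false |- _ => by []
  | H : is_true (~~ true) |- _ => by []
  | H : is_true (~~ (?x == ?x)) |- _ => by rewrite eqxx in H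
  | H : is_true true |- _ => clear H
  | H : ~ is_true _ |- _ => move/negP in H
  | H : is_true (~~ ~~ _) |- _ => rewrite negbK in H
  | H : is_true (~~ (_ || _)) |- _ => rewrite negb_or in H
  | H : is_true (_ && _) |- _ => let H' := fresh in case/andP: H => H H'
  | H : is_true (?x == ?y) |- _ =>
      move/eqP: H => H; first [subst x | subst y | rewrite ?H in *; clear H]
  | H : ?x = ?y |- _ => first [subst x | subst y]
  | H : _ /\ _ |- _ => let H' := fresh in case: H => H H'
  | H : is_true (~~ (_ && _)) |- _ => rewrite negb_and in H
  | H : is_true (_ \in _) |- _ => progress rewrite !inE in H
  | H : is_true (~~ (_ \in _)) |- _ => progress rewrite !inE in H
  | H : _ \/ _ |- _ => case: H => H
  | H : is_true (_ || _) |- _ => case/orP: H => H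
  end.
Ltac bauto :=
  intros;
  match goal with
  | |- is_true (~~ _) => apply/negP => ?
  | |- is_true _ => apply/negPn/negP => ?
  | _ => idtac
  end;
  repeat bsplit1; try done.

(** * Separations *)

Section Separations.

Variables (V : finType) (N : V -> {set V}).
Implicit Types S A X Y Q : {set V}.

(* S separates the set A from the rest of the vertices; N is the neighbourhood
   function. *)
Definition sep (S A : {set V}) : bool :=
  [&& A != set0, [disjoint A & S], [forall x in A, N x \subset A :|: S]
    & A :|: S != setT].

Lemma sepP (S A : {set V}) :
  reflect [/\ exists x, x \in A, forall x, x \in A -> x \notin S,
     forall x y, x \in A -> y \in N x -> (y \in A) || (y \in S)
   & exists z, (z \notin A) && (z \notin S)] (sep S A).
Proof.
apply: (iffP and4P) => [[/set0Pn hx /disjointFr hd /forall_inP hn hz]|[hx hd hn [z hz]]].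
  split=> //.
  - by move=> x /hd ->.
  - by move=> x y xA yx; rewrite -in_setU; exact: (subsetP (hn x xA)).
  - move: hz; rewrite -subTset => /subsetPn[z _]; rewrite inE negb_or => hz.
    by exists z.
split; first exact/set0Pn.
- by rewrite disjoint_subset; apply/subsetP => x xA; rewrite inE; exact: hd.
- apply/forall_inP => x xA; apply/subsetP => y yx; rewrite inE; exact: hn yx.
- by rewrite -subTset; apply/subsetPn; exists z => //; rewrite inE negb_or.
Qed.

Lemma sepI (S A : {set V}) x z :
  x \in A -> (forall x, x \in A -> x \notin S) ->
  (forall x y, x \in A -> y \in N x -> (y \in A) || (y \in S)) ->
  z \notin A -> z \notin S -> sep S A.
Proof.
move=> xA hd hn zA zS; apply/sepP; split=> //; first by exists x.
by exists z; rewrite zA.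
Qed.

Hypothesis Nsym : forall x y, (y \in N x) = (x \in N y).
Hypothesis Nirr : forall x, x \notin N x.
Hypothesis h3 : forall S A, #|S| < 3 -> ~~ sep S A.

Lemma sep_comp S A : sep S A -> sep S (~: (A :|: S)).
Proof.
case/sepP=> [[x xA] hd hn [z hz]]; have xS := hd x xA.
apply: (@sepI _ _ z x); rewrite ?inE ?negb_or ?xA //.
  by move=> y; rewrite !inE; bauto.
move=> y w; rewrite !inE => hy; rewrite Nsym => wy.
apply/negPn/negP => hw.
have wA : w \in A by bauto.
by have := hn w y wA wy; bauto.
Qed.

(** The vertices [a] and [b] may coincide or lie in [A], because the separator used is [[set a; b]
    :\: A]; applications are spared these case distinctions. *)
Lemma no_sep2 (A : {set V}) a b x z :
  x \in A -> (forall x y, x \in A -> y \in N x -> [|| y \in A, y == a | y == b]) ->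
  z \notin A -> z != a -> z != b -> False.
Proof.
move=> xA hn zA za zb.
have hc : #|[set a; b] :\: A| < 3.
  by apply: leq_ltn_trans (subset_leq_card (subsetDl _ _)) _; rewrite cards2; case: eqP.
apply: (negP (h3 A hc)); apply: (@sepI _ _ x z) => //.
- by move=> y yA; rewrite !inE yA.
- move=> y w yA wy; have := hn y w yA wy; rewrite !inE.
  by case: (w \in A).
- by rewrite !inE negb_and (negPf za) (negPf zb) orbT.
Qed.

(** If [s] had no neighbour in [A], then [S :\ s], with fewer than three vertices, would still
    separate [A]. *)
Lemma sep_nbr S A s :
  sep S A -> #|S| <= 3 -> s \in S -> exists2 x, x \in A & s \in N x.
Proof.
move=> hs hS sS.
have [/exists_inP//|/exists_inPn hn] := boolP [exists x in A, s \in N x].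
have hc : #|S :\ s| < 3 by move: hS; rewrite (cardsD1 s S) sS.
case/negP: (h3 A hc); case/sepP: hs => [[x xA] hd hnn [z /andP[zA zS]]].
apply: (@sepI _ _ x z) => //; last by rewrite !inE (negPf zS) andbF.
- by move=> y yA; rewrite !inE (negPf (hd y yA)) andbF.
- move=> y w yA wy; have := hnn y w yA wy; rewrite !inE.
  have: w != s by apply: contraNneq (hn y yA) => <-.
  by move=> ->.
Qed.

Lemma card_set3 (a b c : V) : #|[set a; b; c]| <= 3.
Proof.
rewrite setUC cardsU1 cards2 -[3]/(1 + 2) leq_add ?leq_b1 //.
by case: eqP.
Qed.

Lemma sep3E a b c X : sep [set a; b; c] X ->
  [/\ [/\ a \notin X, b \notin X & c \notin X], [/\ a != b, a != c & b != c],
   [/\ exists2 x, x \in X & a \in N x, exists2 x, x \in X & b \in N x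
     & exists2 x, x \in X & c \in N x],
   exists z, [/\ z \notin X, z != a, z != b & z != c] &
   forall x y, x \in X -> y \in N x -> [|| y \in X, y == a, y == b | y == c]].
Proof.
move=> hs.
have hc : 2 < #|[set a; b; c]| by rewrite ltnNge; apply: contraL hs; exact: h3.
have hu : [/\ a != b, a != c & b != c].
  have h2 x y : (2 < #|[set x; y]|) = false by rewrite cards2; case: eqP.
  split; apply: contraTneq hc => ->; rewrite ?setUid ?h2 //.
    by rewrite setUAC setUid h2.
  by rewrite -setUA setUid h2.
have hn s : s \in [set a; b; c] -> exists2 x, x \in X & s \in N x.
  by apply: sep_nbr => //; exact: card_set3.
case/sepP: (hs) => [hx hd hnn [z hz]].
have hd' s : s \in [set a; b; c] -> s \notin X by apply: contraL => /hd.
split=> //.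
- by split; apply: hd'; rewrite !inE eqxx ?orbT.
- by split; apply: hn; rewrite !inE eqxx ?orbT.
- by exists z; move: hz; rewrite !inE => hz; split; bauto.
- by move=> x y xX /(hnn x y xX); rewrite !inE -!orbA.
Qed.

Lemma card_lt_del (X Y : {set V}) w n :
  w \in X -> #|X| < n.+1 -> (forall y, y \in Y -> (y \in X) && (y != w)) -> #|Y| < n.
Proof.
move=> wX; rewrite (cardsD1 w X) wX add1n ltnS => lX hY; apply: leq_ltn_trans lX.
by apply: subset_leq_card; apply/subsetP => y /hY; rewrite !inE andbC.
Qed.

(** * Degree-3 neighbours of a vertex without contractible edges *)

Variable u : V.
(* No edge incident with u is contractible. *)
Hypothesis hu : forall v, v \in N u -> exists t A, sep [set u; v; t] A.

Definition deg3nbrs : {set V} := [set w | (#|N w| == 3) && (u \in N w)].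
Local Notation D := deg3nbrs.

(* X is crossed with a separation {u, w, t} given by a neighbour w of u in X;
   unless X = {w}, one of the corners contained in X is again such a set. *)
Lemma sep_deg3nbr X a b : sep [set u; a; b] X -> exists2 w, w \in X & w \in D.
Proof.
have [n] := ubnP #|X|; elim: n X a b => // n IH X a b ltn hs.
have [[uX aX bX] [uNa uNb aNb] [[w wX uw] ha hb] [z [zX zu za zb]] hn] := sep3E hs.
have [t [A' hs']] : exists t A, sep [set u; w; t] A by apply: hu; rewrite Nsym.
have small Y c d : sep [set u; c; d] Y -> (forall y, y \in Y -> (y \in X) && (y != w)) ->
    exists2 w, w \in X & w \in D.
  move=> hY sY; have [w' w'Y w'D] := IH Y c d (card_lt_del wX ltn sY) hY.
  by exists w' => //; case/andP: (sY _ w'Y).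
have hnC x y : y \in N x -> [&& x \notin X, x != u, x != a & x != b] -> y \notin X.
  by move=> yx hx; apply/negP => yX; have := hn y x yX; rewrite Nsym yx => /(_ isT); bauto.
have wu : w != u by apply: contraTneq uw => ->; exact: Nirr.
(* If at most one of [a], [b], called [c], lies in [A], then the part of [A] beyond [X] has only [u]
   and [c] as outside neighbours, so it is empty. If neither lies in [A], [c] is taken to be [u]. *)
have farE A c y : sep [set u; w; t] A -> t \in X ->
    (a \notin A) || (a == c) -> (b \notin A) || (b == c) -> c \notin X ->
    [&& y \notin X, y != u, y != a & y != b] -> y \notin A.
  move=> hA tX ac bc cX hy; apply/negP => yA.
  have [[uA wA tA] _ _ _ hnA] := sep3E hA.
  apply: (@no_sep2 (A :\: (X :|: [set u; a; b])) u c y w).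
  - by bauto.
  - move=> x x' xB x'x.
    have hx : [&& x \notin X, x != u, x != a & x != b] by bauto.
    have x'A : [|| x' \in A, x' == u, x' == w | x' == t] by apply: (hnA x) => //; bauto.
    have x'C := hnC x x' x'x hx.
    by clear hA hn hnC hnA hs IH small; bauto.
  - by rewrite !inE wX.
  - by [].
  - by apply: contraNneq cX => <-.
(* Here [c] is whichever of [a], [b] avoids [A] and [t], and [d] is the other one. The corner
   [X :&: A] is then separated by [u], [w], [d]. *)
have near A c d : sep [set u; w; t] A -> t \notin X ->
    [&& c \notin X, d \notin X, c \notin A & c != t] ->
    [set u; c; d] = [set u; a; b] -> 
    (exists2 x, x \in X & x \in A) -> exists2 w, w \in X & w \in D.
  move=> hA tX /and4P[cX dX cA ct] E [x xX xA].
  have [[uA wA tA] _ _ _ hnA] := sep3E hA.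
  apply: (small (X :&: A) w d).
  - apply: (@sepI _ _ x z).
    + by rewrite inE xX.
    + by move=> y; rewrite !inE => yXA; apply/negP => yS; bauto.
    + move=> y y' yXA y'y.
      have y'A : [|| y' \in A, y' == u, y' == w | y' == t] by apply: (hnA y) => //; bauto.
      have y'X : (y' \in X) || (y' \in [set u; a; b]) by have := hn y y'; rewrite !inE -!orbA; apply => //; bauto.
      by move: y'X; rewrite -E => y'X; clear hA hn hnC hnA hs IH small farE E; bauto.
    + by rewrite inE (negPf zX).
    + have zS : z \notin [set u; a; b] by bauto.
      by move: zS; rewrite -E; clear -zX wX; bauto.
  - by move=> y; rewrite !inE => /andP[-> yA]; apply: contraNneq wA => <-.
(* Such an [A] lies beyond [X], so [w] has no neighbour in it and [u], [t] alone would separate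
   it. *)
have far A : sep [set u; w; t] A -> t \notin X ->
    (forall x, x \in X -> x \notin A) -> [&& a \notin A & b \notin A] -> False.
  move=> hA tX XA /andP[aA bA].
  have [[uA wA tA] [uw' ut wt] [[y yA _] _ _] _ hnA] := sep3E hA.
  apply: (@no_sep2 A u t y w) => //.
  move=> x x' xA x'x.
  have hx : [&& x \notin X, x != u, x != a & x != b].
    by have xX : x \notin X := contraL (XA x) xA; clear -uA aA bA xA xX; bauto.
  have x'A := hnA x x' xA x'x; have := hnC _ _ x'x hx.
  by clear -x'A wX; bauto.
(* By [farE] no vertex of [A] lies beyond [X], so all of [A] is a smaller set inside [X]. *)
have same A : sep [set u; w; t] A -> t \in X -> a \notin A -> b \notin A ->
    exists2 w, w \in X & w \in D.
  move=> hA tX aA bA; apply: (small A w t hA) => y yA.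
  have [[uA wA tA] _ _ _ _] := sep3E hA.
  apply/andP; split; last by apply: contraNneq wA => <-.
  apply: contraLR yA => yX; case: (boolP [&& y != u, y != a & y != b]) => hy.
    by apply: (farE A u); rewrite ?aA ?bA ?uX ?yX.
  by clear -hy uA aA bA; bauto.
set B := ~: (A' :|: [set u; w; t]); have hsB : sep [set u; w; t] B := sep_comp hs'.
have hB x : x \in A' -> x \notin B by move=> xA; rewrite !inE xA.
have hAB x : [|| x \in A', x \in B, x == u, x == w | x == t].
  by rewrite /B; bauto.
have [tX|tX] := boolP (t \in X).
  case aA: (a \in A'); case bA: (b \in A').
  - by apply: (same B); rewrite ?hB.
  (* With [a] and [b] on different sides, [farE] applies to both sides and leaves no place for
     [z]. *)
  - have zA : z \notin A' by apply: (farE A' a); rewrite ?bA ?eqxx ?orbT ?zX ?zu ?za.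
    have zB : z \notin B by apply: (farE B b); rewrite ?(hB a) ?eqxx ?orbT ?zX ?zu ?za.
    by have := hAB z; clear -zA zB zX zu tX wX; bauto.
  - have zA : z \notin A' by apply: (farE A' b); rewrite ?aA ?eqxx ?orbT ?zX ?zu ?za.
    have zB : z \notin B by apply: (farE B a); rewrite ?(hB b) ?eqxx ?orbT ?zX ?zu ?za.
    by have := hAB z; clear -zA zB zX zu tX wX; bauto.
  - by apply: (same A'); rewrite ?aA ?bA.
have side A : sep [set u; w; t] A -> (exists2 x, x \in X & x \in A) ->
    (exists2 w, w \in X & w \in D) \/
    ((a \in A) || (a == t)) && ((b \in A) || (b == t)).
  move=> hA hx; have [|hab] := boolP (_ && _); [by right | left].
  have Eba : [set u; b; a] = [set u; a; b] by rewrite setUAC.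
  case/nandP: hab; rewrite negb_or => /andP[cA ct].
    by apply: (near A a b) => //; rewrite aX bX cA.
  by apply: (near A b a) => //; rewrite aX bX cA.
have emp A : (exists2 x, x \in X & x \in A) \/ (forall x, x \in X -> x \notin A).
  have [/exists_inP|/exists_inPn] := boolP [exists x in X, x \in A]; first by left.
  by right.
have [[uA wA tA] _ _ _ _] := sep3E hs'.
have [[uB wB tB] _ _ _ _] := sep3E hsB.
case: (emp A') => eA.
  case: (side _ hs' eA) => // abA.
  have aB : a \notin B by clear -abA hB tB; case/andP: abA => /orP[/hB//|/eqP->].
  have bB : b \notin B by clear -abA hB tB; case/andP: abA => _ /orP[/hB//|/eqP->].
  case: (emp B) => eB; last by case: (far B hsB tX eB); rewrite aB bB.
  by case: (side _ hsB eB) => // abB; clear -abB aB bB aNb; bauto.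
case: (emp B) => eB.
  case: (side _ hsB eB) => // abB.
  have nA c : (c \in B) || (c == t) -> c \notin A'.
    by case/orP => [|/eqP->//]; apply: contraL; exact: hB.
  by case: (far A' hs' tX eA); case/andP: abB => /nA-> /nA->.
(* Neither side meets [X], so [X] consists of [w] alone and the neighbours of [w] are exactly [u],
   [a], [b]. *)
have EX x : x \in X -> x = w.
  move=> xX; have := hAB x; rewrite (negPf (eA _ xX)) (negPf (eB _ xX)) /=.
  by clear -xX uX tX; case/or3P => /eqP // E; subst; bauto.
exists w; rewrite // inE uw andbT.
have -> : N w = [set u; a; b].
  apply/setP => y; apply/idP/idP => [yw|].
    have := hn w y wX yw; rewrite !inE -!orbA => /or4P[/EX E|->|->|->]; rewrite ?orbT //.
    by move: yw; rewrite E (negPf (Nirr w)).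
  case: ha hb => [x xX ax] [x' xX' bx]; rewrite (EX _ xX) in ax; rewrite (EX _ xX') in bx.
  by rewrite !inE -orbA => /or3P[] /eqP->.
by rewrite -setUA cardsU1 cards2 aNb !inE (negPf uNa) (negPf uNb).
Qed.


Lemma card_gt4 v : v \in N u -> 4 < #|V|.
Proof.
move=> /hu[t [A hs]].
have [[uA vA tA] [uv ut vt] [[y yA _] _ _] [z [zA zu zv zt]] _] := sep3E hs.
have ne a : a \notin A -> a != y by move=> aA; apply: contraNneq aA => ->.
have hu5 : uniq [:: u; v; t; y; z].
  rewrite /= !inE !negb_or uv ut vt !ne // ![_ == z]eq_sym zu zv zt /= andbT.
  by rewrite ne.
by have := max_card (mem [:: u; v; t; y; z]); rewrite (card_uniqP hu5).
Qed.

Lemma deg_ge3 x : 3 < #|V| -> 3 <= #|N x|.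
Proof.
rewrite ltnNge => hV; rewrite leqNgt; apply: contra hV => hx.
have : ~~ sep (N x) [set x] := h3 [set x] hx.
have [E _|hne /negP[]] := eqVneq ([set x] :|: N x) setT.
  by rewrite -cardsT -E; apply: leq_trans (leq_card_setU _ _) _; rewrite cards1.
apply/and4P; split=> //.
- by apply/set0Pn; exists x; rewrite inE.
- by rewrite disjoints1 Nirr.
- by apply/forall_inP => w; rewrite inE => /eqP->; rewrite subsetUr.
Qed.

(** * Rims cut by one further vertex *)

Hypothesis hdeg : forall x, 3 <= #|N x|.

(** Otherwise minimum degree 3 would make [u], [a], [b] exactly the neighbours of [w]. For the end
    of a rim, this is what maximality of the rim provides. *)
Lemma notin_deg3nbrs w a b : w \notin D ->
  exists2 y, y \in N w & [&& y != u, y != a & y != b].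
Proof.
move=> wD; apply/exists_inP; apply: contraNT wD => /exists_inPn hN.
have sN : N w \subset [set u; a; b].
  by apply/subsetP => y /hN; bauto.
have hc : #|N w| = 3.
  by apply/eqP; rewrite eqn_leq hdeg (leq_trans (subset_leq_card sN)) ?card_set3.
have/eqP E : N w == [set u; a; b] by rewrite eqEcard sN hc card_set3.
by rewrite inE hc E !inE !eqxx.
Qed.

Lemma deg3nbrs_three w a b c : w \in D -> a \in N w -> b \in N w -> c \in N w ->
  u != a -> u != b -> u != c -> a != b -> a != c -> b != c -> False.
Proof.
rewrite inE => /andP[/eqP hw uw] aw bw cw ua ub uc ab ac bc.
have hu4 : uniq [:: u; a; b; c] by rewrite /= !inE !negb_or ua ub uc ab ac bc.
have : size [:: u; a; b; c] <= size (enum (N w)).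
  apply: uniq_leq_size hu4 _ => y; rewrite mem_enum !inE.
  by case/or4P => /eqP->.
by rewrite -cardE hw.
Qed.

(* Q is the rim of a fan that cannot be extended, s0 and s1 are its two ends. *)
Record fanset Q s0 s1 : Prop := FanSet {
  fs_D : forall x, x \in Q -> x \in D;
  fs_conn : forall X x, x \in Q -> x \in X ->
    (forall x y, x \in Q -> x \in X -> y \in N x -> y \in Q -> y \in X) ->
    forall y, y \in Q -> y \in X;
  fs_N : forall x y, x \in Q -> y \in N x -> [|| y \in Q, y == u, y == s0 | y == s1];
  fs_s0 : exists2 x, x \in Q & forall y, y \in Q -> (s0 \in N y) = (y == x);
  fs_s1 : exists2 x, x \in Q & forall y, y \in Q -> (s1 \in N y) = (y == x);
  fs_s0D : (s0 \notin D) && (s0 != u);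
  fs_s1D : (s1 \notin D) && (s1 != u);
  fs_neq : s0 != s1 }.

Lemma fanset_swap Q s0 s1 : fanset Q s0 s1 -> fanset Q s1 s0.
Proof.
case=> h1 h2 h3' h4 h5 h6 h7 h8; split=> //; last by rewrite eq_sym.
by move=> x y xQ yx; have := h3' x y xQ yx; bauto.
Qed.

(* In G - u - Q, the vertex t separates the part A containing s0 from s1. *)
Record cut_fan Q s0 s1 t A : Prop := CutFan {
  cf_fan : fanset Q s0 s1;
  cf_in : s0 \in A;
  cf_out : (s1 \notin A) && (s1 != t);
  cf_sep : sep (t |: (u |: Q)) A }.

Lemma hub_notin : u \notin D. Proof. by rewrite inE (negPf (Nirr u)) andbF. Qed.

Lemma fs_notin Q s0 s1 : fanset Q s0 s1 -> [&& u \notin Q, s0 \notin Q & s1 \notin Q].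
Proof.
move=> fs; apply/and3P; split; apply/negP => /(fs_D fs); apply/negP; first exact: hub_notin.
  by case/andP: (fs_s0D fs).
by case/andP: (fs_s1D fs).
Qed.

Lemma cut_fan_swap Q s0 s1 t A :
  cut_fan Q s0 s1 t A -> cut_fan Q s1 s0 t (~: (A :|: (t |: (u |: Q)))).
Proof.
move=> [fs s0A /andP[s1A s1t] hs]; split; first exact: fanset_swap.
- have := fs_notin fs; have := fs_s1D fs; rewrite !inE (negPf s1A) (negPf s1t).
  by move=> /andP[_ /negPf->] /and3P[_ _ ->].
- rewrite !inE s0A /=; case/sepP: hs => _ hd _ _; have := hd _ s0A.
  by rewrite !inE negb_or; case/andP.
- exact: sep_comp.
Qed.

(** Inside [A] only [s0] has neighbours on the rim, so [s0] can replace the whole rim as a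
    separator. If [t] were [u] or a rim vertex, which [cut_fan] does not exclude by definition, then
    [u] and [s0] alone would separate [A :\ s0]. *)
Lemma cut_fanE Q s0 s1 t A : cut_fan Q s0 s1 t A ->
  [/\ sep [set u; s0; t] (A :\ s0), (t != u) && (t \notin Q) &
   forall x y, x \in A -> y \in N x -> [|| y \in A, y == t, y == u | (y \in Q) && (x == s0)]].
Proof.
move=> [fs s0A /andP[s1A s1t] hs].
case/sepP: hs => _ hd hn _.
have hN x y : x \in A -> y \in N x ->
    [|| y \in A, y == u, (y == t) && (y \notin Q) | (y \in Q) && (x == s0)].
  move=> xA yx; have h1 := hn x y xA yx; have h2 := hd x xA.
  have yQ : y \in Q -> x == s0.
    move=> yQ; have := @fs_N _ _ _ fs y x yQ; rewrite Nsym => /(_ yx).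
    by clear -h2 xA s1A => h; bauto.
  by clear -h1 yQ; case: (boolP (y \in Q)) yQ => yQ => [/(_ isT) ->|_]; bauto.
have [a aQ ha] := fs_s0 fs.
(* A neighbour of [s0] other than [u], [t] and its unique rim neighbour [a]; it has to lie in [A],
   so [A :\ s0] is nonempty. *)
have [y ys0 /and3P[yu yt ya]] := notin_deg3nbrs t a (proj1 (andP (fs_s0D fs))).
have yA : y \in A.
  have := hn s0 y s0A ys0; rewrite !inE (negPf yu) (negPf yt) /= => /orP[//|yQ].
  by rewrite -(ha _ yQ) Nsym ys0 in ya.
have yA0 : y \in A :\ s0.
  by rewrite !inE yA andbT; apply: contraTneq ys0 => ->; exact: Nirr.
have hN0 x z : x \in A :\ s0 -> z \in N x ->
    [|| z \in A :\ s0, z == u, z == s0 | (z == t) && (z \notin Q)].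
  rewrite inE => /andP[xs xA] zx; have := hN x z xA zx; clear -xs => h.
  by bauto.
have s1N : s1 \notin A :\ s0 by rewrite !inE (negPf s1A) andbF.
have /andP[s1D s1u] := fs_s1D fs; have s01 := fs_neq fs; have /andP[s0D s0u] := fs_s0D fs.
have htt : (t != u) && (t \notin Q).
  apply/negPn/negP => ht.
  apply: (@no_sep2 (A :\ s0) u s0 y s1 yA0 _ s1N) => //; last by rewrite eq_sym.
  move=> x z xA zx; have := hN0 x z xA zx; clear -ht => h.
  by bauto.
split=> //.
- apply: (@sepI _ _ y s1) => //.
  + move=> x; rewrite inE => /andP[xs xA]; have := hd x xA; clear -xs => h; bauto.
  + by move=> x z xA zx; have := hN0 x z xA zx; clear; bauto.
  + by clear -s1t s1u s01; bauto.
- by move=> x z xA zx; have := hN x z xA zx; clear; bauto.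
Qed.

(* The fan on a rim inside A :\ s0 is again cut, by t2 say; according to whether
   t2 lies in Z = V - (A + u + t) or not, one of the sides, possibly intersected
   with A, is a smaller side. *)
Lemma cut_fan_descent (good : Prop) :
  (forall w, w \in D ->
     good \/ exists Q s0 s1 t A, w \in Q /\ cut_fan Q s0 s1 t A) ->
  forall Q s0 s1 t A, cut_fan Q s0 s1 t A -> good.
Proof.
move=> hbad Q s0 s1 t A; have [n] := ubnP #|A|.
elim: n Q s0 s1 t A => // n IH Q s0 s1 t A ltn hb.
have small Q' r0 r1 t' A' x : x \in A -> cut_fan Q' r0 r1 t' A' ->
    (forall y, y \in A' -> (y \in A) && (y != x)) -> good.
  by move=> xA hb' hA'; apply: IH hb'; exact: card_lt_del xA ltn hA'.
have [hs0 /andP[tu tQ] hN] := cut_fanE hb; have [fs s0A /andP[s1A s1t] hs] := hb.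
have /andP[s0D s0u] := fs_s0D fs; have /andP[s1D s1u] := fs_s1D fs; have s01 := fs_neq fs.
have [_ _ [_ _ [y1 y1A ty1]] _ hN0] := sep3E hs0.
have {y1A}/andP[y1s y1A] : (y1 != s0) && (y1 \in A) by move: y1A; rewrite !inE.
have [_ hd hn _] := sepP _ _ hs.
have /and3P[uQ s0Q s1Q] := fs_notin fs.
have tA : t \notin A by apply/negP => /hd; rewrite !inE eqxx.
have uA : u \notin A by apply/negP => /hd; rewrite !inE eqxx orbT.
have QA x : x \in Q -> x \notin A by move=> xQ; apply/negP => /hd; rewrite !inE xQ !orbT.
(* If [y1] is the only neighbour of [t] in [A], it takes over the role of [t] and leaves [A].
   Otherwise [y2] is a second one, kept for the contradiction at the very end. *)
case: (boolP [exists y in A, (t \in N y) && (y != y1)]) => [/exists_inP[y2 y2A /andP[ty2 y21]]|/exists_inPn h1]; last first.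
  apply: (small Q s0 s1 y1 (A :\ y1) y1 y1A); last first.
    by move=> y; rewrite !inE => /andP[-> ->].
  split=> //.
  - by rewrite !inE s0A eq_sym y1s.
  - by rewrite !inE (negPf s1A) andbF; apply: contraNneq s1A => ->.
  - apply: (@sepI _ _ s0 s1).
    + by rewrite !inE s0A eq_sym y1s.
    + by move=> y; rewrite !inE => /andP[yy yA]; have := hd _ yA; clear -yy; bauto.
    + move=> y z; rewrite !inE => /andP[yy yA] zy; have := hn _ _ yA zy.
      have zt : z != t by apply: contra (h1 _ yA) => /eqP<-; rewrite zy yy.
      by clear -zt; bauto.
    + by rewrite !inE (negPf s1A) andbF.
    + have : s1 != y1 by apply: contraNneq s1A => ->.
      by clear -s1u s1Q; bauto.
have [hsB0 _ _] := cut_fanE (cut_fan_swap hb).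
have [_ _ [_ _ [y3 y3B ty3]] _ _] := sep3E hsB0.
have y3A : [&& y3 \notin A, y3 != u & y3 != t] by move: y3B; clear; bauto.
(* Besides possibly [u], the vertex [t] has the neighbours [y1], [y2] in [A] and [y3] on the other
   side, so no rim runs through [t]. *)
have tD : t \notin D.
  have /and3P[a1 a2 a3] := y3A.
  apply/negP => tD; apply: (@deg3nbrs_three t y1 y2 y3 tD); rewrite 1?Nsym //.
  - by apply: contraNneq uA => ->.
  - by apply: contraNneq uA => ->.
  - by rewrite eq_sym.
  - by rewrite eq_sym.
  - by apply: contraNneq a1 => <-.
  - by apply: contraNneq a1 => <-.
have [w wA0 wD] := sep_deg3nbr hs0.
have [//|[Q2 [r0 [r1 [t2 [A2 [wQ2 hb2]]]]]]] := hbad w wD.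
have [fs2 _ _ _] := hb2.
(* A rim is connected and avoids [u], [s0] and [t], so it cannot leave [A :\ s0]. *)
have Q2A x : x \in Q2 -> x \in A :\ s0.
  move: x; apply: (fs_conn fs2 wQ2 wA0) => x y _ xA yx yQ2.
  have yD := fs_D fs2 yQ2.
  have := hN0 x y xA yx; have := hub_notin; clear -yD s0D tD; bauto.
have rA q0 q1 : fanset Q2 q0 q1 -> (q0 \in A) || (q0 == t).
  move=> f2; have [x xQ hx] := fs_s0 f2; have /andP[_ q0u] := fs_s0D f2.
  have := hN0 x q0 (Q2A x xQ); rewrite hx // eqxx => /(_ isT).
  by clear -q0u s0A; bauto.
have Q2A' x : x \in Q2 -> (x \in A) && (x != s0) by move/Q2A; rewrite !inE => /andP[-> ->].
have /andP[wA ws0] := Q2A' w wQ2.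
have [_ /andP[t2u t2Q2] _] := cut_fanE hb2.
have /and3P[uQ2 _ _] := fs_notin fs2.
have tQ2 : t \notin Q2 by apply: contraNN tD; exact: (fs_D fs2).
have s0Q2 : s0 \notin Q2 by apply: contraNN s0D; exact: (fs_D fs2).
have [Z hZ] : exists Z : {set V}, forall x, (x \in Z) = [&& x \notin A, x != u & x != t].
  by exists [set x | [&& x \notin A, x != u & x != t]] => x; rewrite inE.
have hNZ x y : x \in Z -> y \in N x -> [|| y \in Z, y == s0, y == u | y == t].
  rewrite !hZ => xZ yx; have := hN y x; rewrite Nsym => /(_ _ yx) h.
  by case: (boolP (y \in A)) h => yA h; [have := h isT; clear -xZ; bauto|clear; bauto].
have hA1 x y : x \in A -> x != s0 -> y \in N x -> [|| y \in A, y == u | y == t].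
  by move=> xA xs yx; have := hN x y xA yx; clear -xs; bauto.
have hsub q0 q1 B x y : cut_fan Q2 q0 q1 t2 B -> x \in B -> y \in N x ->
    [|| y \in B, y == t2, y == u | y \in Q2].
  by case=> _ _ _ /sepP[_ _ h _] xB yx; have := h x y xB yx; clear; bauto.
have hdis q0 q1 B x : cut_fan Q2 q0 q1 t2 B -> x \in B -> [&& x != t2, x != u & x \notin Q2].
  by case=> _ _ _ /sepP[_ h _ _] xB; have := h x xB; clear; bauto.
have [t2Z|t2Z] := boolP ((t2 \notin A) && (t2 != t)); last first.
  (* The part of [B] in [Z] can be reached from outside only through [u], [s0], [t]. If one of the
     last two, [c], were neither in [B] nor equal to [t2], then [u] and the other one, [c'], would
     separate that part. *)
  have cross B q0 q1 y : cut_fan Q2 q0 q1 t2 B -> y \in B -> y \in Z ->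
      ((t \in B) || (t == t2)) && ((s0 \in B) || (s0 == t2)).
    move=> hB yB yZ; apply/negPn/negP => hc.
    have [c [c' [E cB ct]]] : exists c c', [/\ [set c; c'] = [set s0; t], c \notin B & c != t2].
      by case/nandP: hc => /norP[h1 h2]; [exists t, s0; rewrite setUC|exists s0, t].
    have hst x : (x == s0) || (x == t) = (x == c) || (x == c').
      by have := in_set2 x c c'; rewrite E !inE.
    apply: (@no_sep2 (B :&: Z) u c' y w).
    - by rewrite inE yB.
    - move=> x x'; rewrite inE => /andP[xB xZ] x'x.
      have h1 := hsub _ _ _ _ _ hB xB x'x; have h2 := hNZ _ _ xZ x'x.
      have {}h2 : [|| x' \in Z, x' == u, x' == c | x' == c'].
        by rewrite -hst; clear -h2; bauto.
      have x'Q : (x' \in Q2) ==> (x' \notin Z) && (x' != c).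
        apply/implyP => /[dup] x'Q /Q2A'/andP[x'A x's].
        rewrite hZ x'A /=; apply: contraTneq x'Q => E'; have := hst x'.
        by rewrite E' eqxx => /orP[/eqP->|/eqP->].
      have x't : (x' == t2) ==> (x' \notin Z) && (x' != c).
        apply/implyP => /eqP->; rewrite eq_sym ct andbT; rewrite hZ; move: t2Z; clear; bauto.
      have x'c : (x' == c) ==> (x' \notin B) by apply/implyP => /eqP->.
      move: h1 h2 x'Q x't x'c; rewrite !inE.
      by case: (x' \in B); case: (x' \in Q2); case: (x' == t2); case: (x' == u);
        case: (x' == c); case: (x' == c'); case: (x' \in Z).
    - by rewrite inE hZ wA andbF.
    - by apply: contraNneq uA => <-.
    - have : (w == s0) || (w == t) = false.
        by rewrite (negPf ws0); apply: contraNF tA => /eqP<-.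
      by rewrite hst => /norP[].
  (* A side that misses [Z] lies in [A] and misses [w]: it cannot contain [t], since then it would
     also contain [y3], which is in [Z]. *)
  have avoid B q0 q1 : cut_fan Q2 q0 q1 t2 B -> (forall y, y \in B -> y \notin Z) -> good.
    move=> hB hBZ; apply: (small _ _ _ _ _ w wA hB) => y yB.
    have tB : t \notin B.
      apply/negP => tB; have := hsub _ _ _ _ y3 hB tB; rewrite Nsym ty3 => /(_ isT).
      have y3Z : y3 \in Z by rewrite hZ.
      have y3Q : y3 \notin Q2 by apply/negP => /Q2A'; case/and3P: y3A => /negPf->.
      have := hBZ y3; rewrite y3Z; clear -y3Q y3A t2Z.
      by case: (y3 \in B) => [/(_ isT)//|_]; bauto.
    have := hBZ y yB; rewrite hZ; have := hdis _ _ _ _ hB yB.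
    have : y != w by apply: contraTneq wQ2 => <-; case/and3P: (hdis _ _ _ _ hB yB).
    by have : y != t by [apply: contraNneq tB => <-]; clear; bauto.
  have [/exists_inP[y yA2 yZ]|/exists_inPn h] := boolP [exists y in A2, y \in Z]; last exact: avoid hb2 h.
  have [/exists_inP[y' yB2 yZ']|/exists_inPn h] := boolP [exists y in ~: (A2 :|: (t2 |: (u |: Q2))), y \in Z]; last exact: avoid (cut_fan_swap hb2) h.
  (* If both sides meet [Z], then [s0] and [t] belong to both up to [t2], so both equal [t2]. *)
  have /andP[h1 h2] := cross _ _ _ _ hb2 yA2 yZ.
  have /andP[h3' h4] := cross _ _ _ _ (cut_fan_swap hb2) yB2 yZ'.
  have tt2 : t == t2 by move: h1 h3'; clear; bauto.
  have st2 : s0 == t2 by move: h2 h4; clear; bauto.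
  by case/negP: tA; rewrite (eqP tt2) -(eqP st2).
case/andP: t2Z => t2A t2t.
(* Now [t2] lies in [Z]. At least one of the two sides misses [t]; [B] is such a side and [q0] the
   end of the rim in it. *)
have main q0 q1 B : cut_fan Q2 q0 q1 t2 B -> t \notin B -> good.
  move=> hB tB; have [f2 q0B /andP[q1B q1t] hsB] := hB.
  have q0A : q0 \in A.
    by case/orP: (rA _ _ f2) => // /eqP E; rewrite -E q0B in tB.
  have hBA x y : x \in B -> x \in A -> x != s0 -> y \in N x ->
     [|| (y \in B) && (y \in A), y == u | y \in Q2].
    move=> xB xA xs yx; have := hA1 x y xA xs yx; have := hsub _ _ _ _ _ hB xB yx.
    by move: t2A t2t tB tQ2; clear; bauto.
  have s0B : s0 \in B.
    (* If [s0] were outside [B], the part of [B] in [A] together with the rim would have only [u]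
       and [q1] as outside neighbours. *)
    apply/negPn/negP => s0B.
    apply: (@no_sep2 ((B :&: A) :|: Q2) u q1 w t2).
    - by rewrite !inE wQ2 orbT.
    - move=> x y; rewrite !inE => /orP[/andP[xB xA]|xQ] yx.
        have xs : x != s0 by apply: contraNneq s0B => <-.
        by have := hBA x y xB xA xs yx; clear; bauto.
      by have := fs_N f2 xQ yx; move: q0A q0B; clear; bauto.
    - by rewrite !inE (negPf t2A) andbF.
    - by [].
    - by rewrite eq_sym.
  pose B2 := ~: (B :|: (t2 |: (u |: Q2))); have hB2 := cut_fan_swap hB; rewrite -/B2 in hB2.
  have [C hC] : exists C : {set V}, forall x, (x \in C) = (x \in B2) && (x \in A).
    by exists (B2 :&: A) => x; rewrite inE.
  have BB2 x : x \in B -> x \notin B2 by rewrite !inE => ->.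
  have hCC x y : x \in C -> y \in N x -> [|| y \in C, y == u, y == t | y \in Q2].
    rewrite !hC => /andP[xB xA] yx.
    have xs : x != s0 by apply: contraTneq xB => ->; exact: BB2.
    have := hA1 x y xA xs yx; have := hsub _ _ _ _ _ hB2 xB yx.
    by move: t2A t2t; clear; bauto.
  have wC : w \notin C by rewrite hC !inE wQ2 !orbT.
  have wt : w != t by apply: contraNneq tQ2 => <-.
  have wu : w != u by apply: contraNneq uQ2 => <-.
  have q1E : q1 != t -> q1 \in C.
    move=> q1t'; have := rA _ _ (fanset_swap f2); rewrite (negPf q1t') orbF hC => ->.
    have /and3P[_ _ q1Q] := fs_notin f2; have /andP[_ q1u] := fs_s1D f2.
    by rewrite !inE negb_or q1B negb_or q1t negb_or q1u q1Q.
  (* If [q1] is not [t], then [t] cuts the fan with [C] as a smaller side. If it is, [C] is empty,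
     since [u] and [t] would separate it; then all neighbours of [t] in [A] lie on the rim, but an
     end has just one neighbour there while [y1] and [y2] are two. *)
  have [E|q1t'] := eqVneq q1 t; last first.
    apply: (small Q2 q1 q0 t C w wA); last first.
      move=> y yC; have yw : y != w by apply: contraNneq wC => <-.
      by rewrite yw andbT; move: yC; rewrite hC => /andP[].
    have q0t : q0 != t by apply: contraNneq tB => <-.
    have q0C : q0 \notin C by rewrite hC (negPf (BB2 _ q0B)).
    split; [exact: fanset_swap | exact: q1E | by rewrite q0C |].
    apply: (@sepI _ _ q1 q0) => //.
    - exact: q1E.
    - move=> x; rewrite hC => /andP[xB xA]; have := hdis _ _ _ _ hB2 xB.
      by have : x != t by [apply: contraNneq tA => <-]; clear; bauto.
    - by move=> x y xC yx; have := hCC x y xC yx; clear; bauto.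
    - have /and3P[_ q0Q _] := fs_notin f2; have /andP[_ q0u] := fs_s0D f2.
      by rewrite !inE !negb_or q0t q0u.
  have C0 x : x \notin C.
    apply/negP => xC; apply: (@no_sep2 C u t x w) => // {}x y {}xC yx.
    have := hCC x y xC yx; case: (boolP (y \in Q2)) => [yQ _|]; last by rewrite orbF.
    have := fs_N f2 yQ; move=> /(_ x); rewrite Nsym => /(_ yx); rewrite E.
    move: xC; rewrite hC => /andP[xB xA].
    have := hdis _ _ _ _ hB2 xB; have : x != q0 by apply: contraTneq xB => ->; exact: BB2.
    have : x != t by apply: contraNneq tA => <-.
    by clear; bauto.
  have yQ y : y \in A -> t \in N y -> y \in Q2.
    move=> yA ty; apply/negPn/negP => yQ; have := C0 y; rewrite hC yA andbT.
    have yB : y \notin B.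
      apply/negP => yB; have := hsub _ _ _ _ _ hB yB ty.
      by move: tB t2t tu tQ2; clear; bauto.
    have yt2 : y != t2 by apply: contraTneq yA => ->.
    have yu : y != u by apply: contraTneq yA => ->.
    by rewrite !inE (negPf yB) (negPf yt2) (negPf yu) (negPf yQ).
  have [x xQ hx] := fs_s1 f2; rewrite E in hx.
  have := hx y1 (yQ y1 y1A ty1); have := hx y2 (yQ y2 y2A ty2).
  by rewrite ty1 ty2 => /esym/eqP e2 /esym/eqP e1; rewrite e1 e2 eqxx in y21.
have [tA2|tA2] := boolP (t \in A2); last exact: main hb2 tA2.
by apply: main (cut_fan_swap hb2) _; rewrite !inE tA2.
Qed.

(** A side containing neither end of the rim has no neighbour on the rim, so [u] and [t] alone would
    separate it. Hence the two ends are distributed over the two sides. *)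
Lemma sep_cut_fan Q s0 s1 t A : fanset Q s0 s1 -> sep (t |: (u |: Q)) A ->
  exists q0 q1, cut_fan Q q0 q1 t A.
Proof.
move=> fs.
have key B : sep (t |: (u |: Q)) B -> (s0 \in B) || (s1 \in B).
  case/sepP=> [[x xB] hd hn [z /andP[zB zS]]].
  apply/negPn/negP => /norP[s0B s1B].
  have zu : z != u by move: zS; clear; bauto.
  have zt : z != t by move: zS; clear; bauto.
  apply: (no_sep2 xB _ zB zu zt) => {}x y {}xB yx.
  have := hn x y xB yx; have := hd x xB; have := @fs_N _ _ _ fs y x.
  rewrite Nsym yx !inE !negb_or; case: (y \in Q) => [/(_ isT isT) h|_]; last by clear; bauto.
  by case/and3P=> _ xu xQ _; move: xB; case/or4P: h => [h|h|/eqP->|/eqP->];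
    rewrite ?(negPf s0B) ?(negPf s1B) //; rewrite h in xQ xu.
move=> hs; have := key _ hs; have := key _ (sep_comp hs).
rewrite !inE !negb_or.
have [[/and3P[uQ s0Q s1Q] /andP[_ s0u]] /andP[_ s1u]] := (fs_notin fs, fs_s0D fs, fs_s1D fs).
case s0A: (s0 \in A) => /=; case s1A: (s1 \in A) => //=.
- move=> h _; exists s0, s1; split=> //.
  by rewrite s1A; case/andP: h => ->.
- rewrite orbF => h _; exists s1, s0; split=> //; first exact: fanset_swap.
  by rewrite s0A; case/andP: h => ->.
Qed.

(** * Rims *)

Record fanpath n (v : nat -> V) : Prop := FanPath {
  fp_u : forall i, i <= n.+1 -> u != v i;
  fp_inj : forall i j, i < j <= n.+1 -> v i = v j -> i = 0 /\ j = n.+1;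
  fp_N : forall i, 0 < i <= n -> N (v i) = [set u; v i.-1; v i.+1] }.

Definition rim n (v : nat -> V) : {set V} := [set v i.+1 | i : 'I_n].

Lemma rimP n v x : reflect (exists2 i, 0 < i <= n & x = v i) (x \in rim n v).
Proof.
apply: (iffP imsetP) => [[i _ ->]|[[|i] // lin ->]]; first by exists i.+1 => //=.
by exists (Ordinal lin).
Qed.

Lemma mem_rim n v i : 0 < i <= n -> v i \in rim n v.
Proof. by move=> hi; apply/rimP; exists i. Qed.

(** The two ways in which a rim stops growing; the common end of a closed rim may itself be in
    [D]. *)
Definition terminal n (v : nat -> V) : Prop :=
  v 0 = v n.+1 \/ ((v 0 \notin D) && (v n.+1 \notin D)).

Definition revpath n (v : nat -> V) : nat -> V := fun i => v (n.+1 - i).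

Lemma rim_rev n v : rim n (revpath n v) = rim n v.
Proof.
apply/setP => x; apply/rimP/rimP => -[i /andP[i0 lin] ->]; exists (n.+1 - i) => //.
- by lia.
- by lia.
by rewrite /revpath subKn // ltnW.
Qed.

Lemma fanpath_rev n v : fanpath n v -> fanpath n (revpath n v).
Proof.
case=> hu' hi hN; split.
- by move=> i _; apply: hu'; exact: leq_subr.
- move=> i j ij E.
  by have [||e1 e2] := hi (n.+1 - j) (n.+1 - i); [lia|exact: esym E|lia].
- case=> [//|i] hin; rewrite /revpath subSS hN; last by lia.
  by rewrite setUAC -subnS (_ : (n - i).+1 = n.+1 - i) //; lia.
Qed.

Lemma rim_deg3 n v x : fanpath n v -> x \in rim n v -> x \in D.
Proof.
move=> hp /rimP[i hi ->]; rewrite inE eqn_leq hdeg (fp_N hp hi) card_set3.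
by rewrite !inE eqxx.
Qed.

Lemma rim_conn n v X x : fanpath n v -> x \in rim n v -> x \in X ->
  (forall x y, x \in rim n v -> x \in X -> y \in N x -> y \in rim n v -> y \in X) ->
  forall y, y \in rim n v -> y \in X.
Proof.
move=> hp /rimP[i hi ->{x}] iX hX _ /rimP[j hj ->].
have up k : i + k <= n -> v (i + k) \in X.
  elim: k => [|k IH]; rewrite ?addn0 // addnS => lk.
  apply: (hX _ _ (mem_rim v _) (IH _)); rewrite ?mem_rim //; try lia.
  by rewrite (fp_N hp) ?inE ?eqxx ?orbT //; lia.
have down k : k < i -> v (i - k) \in X.
  elim: k => [|k IH]; rewrite ?subn0 // => lk.
  apply: (hX _ _ (mem_rim v _) (IH (ltnW lk))); rewrite ?mem_rim //; try lia.
  by rewrite (fp_N hp) ?subnS ?inE ?eqxx ?orbT //; lia.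
case: (leqP i j) => ij; first by rewrite -(subnKC ij) up //; lia.
by rewrite -(subKn (ltnW ij)) down //; lia.
Qed.

Lemma rim_N n v x y : fanpath n v -> x \in rim n v -> y \in N x ->
  [|| y \in rim n v, y == u, y == v 0 | y == v n.+1].
Proof.
move=> hp /rimP[i hi ->]; rewrite (fp_N hp hi) !inE -orbA => /or3P[->|/eqP->|/eqP->].
- by rewrite orbT.
- by have [->|i1] := eqVneq i 1; rewrite ?eqxx ?orbT // mem_rim //; lia.
- by have [->|i1] := eqVneq i n; rewrite ?eqxx ?orbT // mem_rim //; lia.
Qed.

Lemma fanset_path n v : 0 < n -> fanpath n v -> v 0 != v n.+1 ->
  v 0 \notin D -> v n.+1 \notin D -> fanset (rim n v) (v 0) (v n.+1).
Proof.
(* Stated for an arbitrary path, so that the reversed path yields the claim for the other end. *)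
have first m w : 0 < m -> fanpath m w -> w 0 != w m.+1 ->
    exists2 x, x \in rim m w & forall y, y \in rim m w -> (w 0 \in N y) = (y == x).
  move=> m0 hp ne; exists (w 1); first exact: mem_rim.
  move=> _ /rimP[j hj ->]; rewrite (fp_N hp hj) !inE eq_sym (negPf (fp_u hp (leq0n _))) /=.
  case: j hj => [//|[|j]] hj; rewrite /= ?eqxx //.
  rewrite [RHS](introF eqP) => [|E]; last first.
    by have [|] := @fp_inj _ _ hp 1 j.+2 _ (esym E); lia.
  apply/norP; split; apply/eqP => E.
    by have [|] := @fp_inj _ _ hp 0 j.+1 _ E; lia.
  by have [|_ e] := @fp_inj _ _ hp 0 j.+3 _ E; [lia|rewrite E e eqxx in ne].
move=> n0 hp ne h0 h1; split=> //.
- by move=> x; exact: rim_deg3.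
- by move=> X x; exact: rim_conn.
- by move=> x y; exact: rim_N.
- exact: first.
- have [|x] := first n (revpath n v) n0 (fanpath_rev hp); rewrite /revpath ?subnn ?subn0 1?eq_sym //.
  by rewrite rim_rev; exists x.
- by rewrite h0 eq_sym (fp_u hp).
- by rewrite h1 eq_sym (fp_u hp).
Qed.

Lemma size_fanpath n v : fanpath n v -> n < #|V|.
Proof.
move=> hp; have hu' : uniq [seq v i | i <- iota 0 n.+1].
  rewrite map_inj_in_uniq ?iota_uniq // => i j; rewrite !mem_iota !add0n /= => hi hj E.
  case: (ltngtP i j) => // h.
    have [] := @fp_inj _ _ hp i j _ E; first by rewrite h ltnW.
    by move=> _ e; rewrite e ltnn in hj.
  have [] := @fp_inj _ _ hp j i _ (esym E); first by rewrite h ltnW.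
  by move=> _ e; rewrite e ltnn in hi.
have := max_card (mem [seq v i | i <- iota 0 n.+1]).
by rewrite (card_uniqP hu') size_map size_iota.
Qed.

(** The new end is the third neighbour [y] of [v n.+1]. It is no earlier rim vertex, because the
    neighbours of those are known; [y = v 0] remains possible and closes the rim. *)
Lemma fanpath_extend n v : 0 < n -> fanpath n v -> v 0 != v n.+1 -> v n.+1 \in D ->
  exists v', fanpath n.+1 v' /\ rim n v \subset rim n.+1 v'.
Proof.
move=> n0 hp ne lD.
have hn : 0 < n <= n by rewrite n0 /=.
have vn : v n \in N (v n.+1) by rewrite Nsym (fp_N hp hn) !inE eqxx !orbT.
have un : u \in N (v n.+1) by move: lD; rewrite inE => /andP[].
have uvn : u != v n by apply: (fp_u hp).
have [y yN /andP[yu yv]] : exists2 y, y \in N (v n.+1) & (y != u) && (y != v n).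
  apply/exists_inP; apply: contraT => /exists_inPn h.
  have := hdeg (v n.+1); rewrite leqNgt => /negP[].
  have: N (v n.+1) \subset [set u; v n].
    by apply/subsetP => y /h; rewrite !inE negb_and !negbK.
  by move/subset_leq_card/leq_ltn_trans; apply; rewrite cards2; case: eqP.
have EN : N (v n.+1) = [set u; v n; y].
  apply/esym/eqP; rewrite eqEcard; apply/andP; split.
    by apply/subsetP => x; rewrite !inE -orbA => /or3P[] /eqP->.
  by move: lD; rewrite inE => /andP[/eqP-> _]; rewrite -setUA cardsU1 cards2 !inE
    negb_or uvn (eq_sym u) yu eq_sym yv.
have yi i : 0 < i <= n.+1 -> y != v i.
  move=> hi; have [->|i1] := eqVneq i n.+1.
    by apply: contraTneq yN => ->; exact: Nirr.
  have [->//|i2] := eqVneq i n.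
  apply: contraTneq yN => ->; rewrite Nsym (fp_N hp); last by lia.
  rewrite !inE !negb_or eq_sym (fp_u hp) //=; apply/andP; split; apply/eqP => E.
    by have [|e _] := @fp_inj _ _ hp i.-1 n.+1 _ (esym E); [lia|rewrite E e eqxx in ne].
  by have [|] := @fp_inj _ _ hp i.+1 n.+1 _ (esym E); lia.
exists (fun i => if i <= n.+1 then v i else y); split.
- split.
  + by move=> i _; case: ifP => [/(fp_u hp)//|_]; rewrite eq_sym.
  + move=> i j hij; rewrite (_ : i <= n.+1); last by lia.
    have [->|jn] := eqVneq j n.+2.
      rewrite ltnn => E; have [->//|i0] := eqVneq i 0.
      by have := yi i; rewrite E eqxx => /(_ ltac:(lia)).
    rewrite (_ : j <= n.+1); last by lia.
    move=> E; have [|e1 e2] := @fp_inj _ _ hp i j _ E; first by lia.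
    by rewrite e1 e2 in E; rewrite E eqxx in ne.
  + move=> i hi; have [->|i1] := eqVneq i n.+1; first by rewrite /= leqnn leqnSn ltnn.
    by rewrite !ifT ?(fp_N hp) //; lia.
- apply/subsetP => _ /rimP[i /andP[i0 hi] ->].
  by apply/rimP; exists i; rewrite ?i0 ?leqW // .
Qed.

(** The length is bounded by [#|V|]. Growth at the near end is obtained by reversing the path. *)
Lemma terminal_path n v w : 0 < n -> fanpath n v -> w \in rim n v ->
  exists n' v', [/\ 0 < n', fanpath n' v', terminal n' v' & w \in rim n' v'].
Proof.
have [m] := ubnP (#|V| - n); elim: m n v => // m IH n v hm n0 hp hw.
have hn := size_fanpath hp.
have grow v1 : fanpath n v1 -> v1 0 != v1 n.+1 -> v1 n.+1 \in D -> w \in rim n v1 ->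
    exists n' v', [/\ 0 < n', fanpath n' v', terminal n' v' & w \in rim n' v'].
  move=> hp1 ne lD hw1; have [v' [hp' /subsetP hs]] := fanpath_extend n0 hp1 ne lD.
  by apply: (IH n.+1 v'); [lia| |exact: hp'|exact: hs].
have [E|ne] := eqVneq (v 0) (v n.+1); first by exists n, v; split=> //; left.
have [h1|h1] := boolP (v n.+1 \in D); first exact: grow hp ne h1 hw.
have [h0|h0] := boolP (v 0 \in D); last by exists n, v; split=> //; right; rewrite h0.
apply: (grow (revpath n v) (fanpath_rev hp)); rewrite ?rim_rev /revpath ?subnn ?subn0 //.
by rewrite eq_sym.
Qed.

Lemma wye_path w : w \in D -> exists v, fanpath 1 v /\ w \in rim 1 v.
Proof.
rewrite inE => /andP[/eqP hw uw].
have /cards2P[p [q [pq E]]] : #|N w :\ u| == 2.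
  by apply/eqP; move: hw; rewrite (cardsD1 u) uw add1n => -[].
have EN : N w = [set u; p; q] by rewrite -setUA -E setD1K.
have h x : x \in [set p; q] -> (u != x) && (x != w).
  rewrite -E !inE eq_sym => /andP[-> xw].
  by apply: contraTneq xw => ->; exact: Nirr.
have [/andP[up pw] /andP[uq qw]] : (u != p) && (p != w) /\ (u != q) && (q != w).
  by split; apply: h; rewrite !inE eqxx ?orbT.
have uw' : u != w by apply: contraTneq uw => ->; exact: Nirr.
exists (fun i => if i is i'.+1 then if i' is 0 then w else q else p); split.
  split.
  - by case=> [|[|i]].
  - case=> [|[|[|i]]] [|[|[|j]]] // hij E'; try by case/andP: hij.
    + by rewrite E' eqxx in pw.
    + by rewrite E' eqxx in qw.
  - by case=> [|[|i]].
by apply/rimP; exists 1.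
Qed.

(** A closed rim has only [u] and [v 0] as outside neighbours, and these two cannot separate it from
    anything. *)
Lemma ring_cover n v y : 0 < n -> fanpath n v -> v 0 = v n.+1 ->
  y \notin rim n v -> y != u -> y = v 0.
Proof.
move=> n0 hp E yR yu; apply/eqP/negPn/negP => y0.
apply: (@no_sep2 (rim n v) u (v 0) (v 1) y) => //; first exact: mem_rim.
by move=> a b aR bN; have := rim_N hp aR bN; rewrite -E; clear; bauto.
Qed.

Lemma ring_no_sep n v t A : 0 < n -> fanpath n v -> v 0 = v n.+1 ->
  ~~ sep (t |: (u |: rim n v)) A.
Proof.
move=> n0 hp E; apply/negP => /sepP[[x xA] hd _ [z /andP[zA zS]]].
have [xS zx] : x \notin t |: (u |: rim n v) /\ z != x.
  by split; [exact: hd | apply: contraNneq zA => ->].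
have [xR xu] : x \notin rim n v /\ x != u by move: xS; clear; split; bauto.
have [zR zu] : z \notin rim n v /\ z != u by move: zS; clear; split; bauto.
by rewrite (ring_cover n0 hp E xR xu) (ring_cover n0 hp E zR zu) eqxx in zx.
Qed.

(** The last conjunct is the condition under which [contract_connected] makes the contraction of the
    fan 3-connected. *)
Lemma hub_fan v0 : v0 \in N u ->
  exists n v, [/\ 0 < n, fanpath n v, terminal n v
    & forall t A, ~~ sep (t |: (u |: rim n v)) A].
Proof.
move=> uv0.
have step w : w \in D ->
  (exists n v, [/\ 0 < n, fanpath n v, terminal n v
    & forall t A, ~~ sep (t |: (u |: rim n v)) A]) \/
  exists Q s0 s1 t A, w \in Q /\ cut_fan Q s0 s1 t A.
  move=> wD; have [v1 [hp1 hw1]] := wye_path wD.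
  have [n [v [n0 hp ht hw]]] := terminal_path (ltn0Sn 0) hp1 hw1.
  have [/existsP[t /existsP[A hs]]|/existsPn hno] :=
    boolP [exists t, exists A, sep (t |: (u |: rim n v)) A]; last first.
    left; exists n, v; split=> // t A.
    by have := hno t; rewrite negb_exists => /forallP.
  case: ht => [E|/andP[h0 h1]]; first by have := ring_no_sep t A n0 hp E; rewrite hs.
  have [E|ne] := eqVneq (v 0) (v n.+1); first by have := ring_no_sep t A n0 hp E; rewrite hs.
  right; have [q0 [q1 hb]] := sep_cut_fan (fanset_path n0 hp ne h0 h1) hs.
  by exists (rim n v), q0, q1, t, A.
have [t [A hs]] := hu uv0; have [w _ wD] := sep_deg3nbr hs.
have [//|[Q [s0 [s1 [t' [A' [_ hb]]]]]]] := step w wD.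
exact: cut_fan_descent step _ _ _ _ _ hb.
Qed.

(** * Size of the rim, degree of the hub, and rim edges *)

Lemma card_rim n v : fanpath n v -> #|rim n v| = n.
Proof.
move=> hp; rewrite card_imset ?card_ord // => i j E; apply: val_inj.
case: (ltngtP i j) => // h.
  by have [|] := @fp_inj _ _ hp i.+1 j.+1 _ E; rewrite ?ltnS ?h // ltnW.
by have [|] := @fp_inj _ _ hp j.+1 i.+1 _ (esym E); rewrite ?ltnS ?h // ltnW.
Qed.

(** For [n = 1] hub and rim are the two ends of an edge at [u], and [hu] supplies a separation
    through them. So the fan found has at least one rim edge. *)
Lemma no_sep_size n v : 0 < n -> fanpath n v ->
  (forall t A, ~~ sep (t |: (u |: rim n v)) A) -> 1 < n.
Proof.
move=> n0 hp hno; rewrite ltn_neqAle n0 andbT; apply/eqP => n1; subst n.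
have hv : v 1 \in N u.
  by have := rim_deg3 hp (mem_rim v (isT : 0 < 1 <= 1)); rewrite inE Nsym => /andP[].
have [t [A hs]] := hu hv; case/negP: (hno t A).
suff -> : t |: (u |: rim 1 v) = [set u; v 1; t] by [].
apply/setP => x; rewrite !inE orbC; congr (_ || _); congr (_ || _).
by apply/rimP/eqP => [[[|[|i]] // _ ->]|->] //; exists 1.
Qed.

(** Otherwise a separator through [u] and [z] would leave a neighbour of [u] on each side,
    necessarily [x] and [y], which are adjacent. Hence a hub with two adjacent degree-3 neighbours
    is not itself of degree 3. *)
Lemma hub_deg x y z : x \in D -> y \in D -> x \in N y -> ~~ (N u \subset [set x; y; z]).
Proof.
move=> xD yD xy; apply/negP => hs.
have ED : N u = [set x; y; z].
  by apply/eqP; rewrite eqEcard hs (leq_trans (card_set3 _ _ _)).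
have [t [A hsep]] : exists t A, sep [set u; z; t] A.
  by apply: hu; rewrite ED !inE eqxx !orbT.
have [[uA zA _] _ [[a aA ua] _ _] _ hn] := sep3E hsep.
have [[uB zB _] _ [[b bB ub] _ _] _ _] := sep3E (sep_comp hsep).
have mem c : u \in N c -> c != z -> (c == x) || (c == y).
  by rewrite Nsym ED !inE -orbA => /or3P[->|->|->]; rewrite ?orbT.
have az : a != z by apply: contraNneq zA => <-.
have bz : b != z by apply: contraNneq zB => E; rewrite E in bB.
have ba : b \in N a.
  have ab : a != b by apply: contraTneq bB => <-; rewrite !inE aA.
  have := mem a ua az; have := mem b ub bz.
  by case/orP => /eqP Eb; case/orP => /eqP Ea; subst; rewrite ?eqxx // Nsym in ab *.
by have := hn a b aA ba; move: bB; clear; bauto.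
Qed.

(** If [u] lies on a side, then [x] and [y] have no other neighbour there, so [u] and [t] separate
    the rest of that side, or the side is just [u], against [hub_deg]. Otherwise [u] is [t], and [x]
    has too many neighbours: [u], [y] and one on each side. *)
Lemma deg3_edge_no_sep x y t A : x \in D -> y \in D -> x \in N y ->
  ~~ sep [set x; y; t] A.
Proof.
move=> xD yD xy; apply/negP.
have key B : sep [set x; y; t] B -> u \notin B.
  move=> hs; apply/negP => uB.
  have [[xB yB tB] _ _ _ hn] := sep3E hs.
  have [_ _ [[x' x'C xx'] [y' y'C yy'] _] _ _] := sep3E (sep_comp hs).
  have only a b c d : a \in D -> a \notin B -> b \notin B -> b \in N a -> c \notin B ->
      c \in N a -> b != c -> d \in B -> d \in N a -> d = u.
    move=> aD aB bB ba cB ca bc dB da; apply/eqP/negPn/negP => du.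
    apply: (@deg3nbrs_three a b c d aD ba ca da) => //.
    - by apply: contraNneq bB => <-.
    - by apply: contraNneq cB => <-.
    - by rewrite eq_sym.
    - by apply: contraNneq bB => ->.
    - by apply: contraNneq cB => ->.
  have [x'B x'y y'B y'x] : [/\ x' \notin B, y != x', y' \notin B & x != y'].
    by move: x'C y'C; clear; split; bauto.
  have onlyx d : d \in B -> d \in N x -> d = u.
    by apply: (only x y x'); rewrite // Nsym.
  have onlyy d : d \in B -> d \in N y -> d = u.
    by apply: (only y x y'); rewrite // Nsym.
  have hn' a b : a \in B -> a != u -> b \in N a -> (b \in B) || (b == t).
    move=> aB au ba; have := hn a b aB ba; case/or4P => [->|/eqP E|/eqP E|->]; rewrite ?orbT //; subst.
      by rewrite (onlyx a) ?eqxx // Nsym in au.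
    by rewrite (onlyy a) ?eqxx // Nsym in au.
  have xu : x != u by apply: contraNneq xB => ->.
  have [E|/set0Pn[a aB]] := eqVneq (B :\ u) set0.
    have := hub_deg t xD yD xy; case/negP; apply/subsetP => b bu.
    have := hn u b uB bu; rewrite !inE -!orbA; case/orP => // bB.
    have : b \in B :\ u by rewrite !inE bB andbT; apply: contraTneq bu => ->; exact: Nirr.
    by rewrite E inE.
  have [_ [xy' xt yt] _ _ _] := sep3E hs.
  apply: (@no_sep2 (B :\ u) u t a x aB) => //.
    move=> c d; rewrite !inE => /andP[cu cB] dc; have := hn' c d cB cu dc.
    by clear; bauto.
  by rewrite !inE (negPf xB) andbF.
move=> hs; have uA := key _ hs; have := key _ (sep_comp hs).
have ux : u != x by apply: contraTneq xD => <-; exact: hub_notin.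
have uy : u != y by apply: contraTneq yD => <-; exact: hub_notin.
rewrite !inE (negPf uA) (negPf ux) (negPf uy) /= negbK => /eqP ut; subst t.
have [_ _ [[a aA xa] _ _] _ _] := sep3E hs.
have [_ _ [[b bB xb] _ _] _ _] := sep3E (sep_comp hs).
have [[_ yA _] _ _ _ _] := sep3E hs.
apply: (@deg3nbrs_three x y a b xD); rewrite 1?Nsym // ?inE //.
- by apply: contraNneq uA => ->.
- by move: bB; clear; bauto.
- by apply: contraNneq yA => ->.
- by move: bB; clear; bauto.
- by move: bB aA; clear; bauto.
Qed.

End Separations.

Lemma set2_eq (T : finType) (a b c d : T) :
  [set a; b] = [set c; d] -> (a = c /\ b = d) \/ (a = d /\ b = c).
Proof.
move=> E; have h x : (x \in [set a; b]) = (x \in [set c; d]) by rewrite E.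
have := (h a, h b, h c, h d); rewrite !inE !eqxx /= !orbT => -[[[/esym ha /esym hb] hc] hd].
case/orP: ha => /eqP ha; case/orP: hb => /eqP hb; subst; auto.
  by move: hd; rewrite orbb eq_sym => /eqP; auto.
by move: hc; rewrite orbb eq_sym => /eqP; auto.
Qed.

Lemma set3_rest (T : finType) (a b c x y : T) : x \in [set a; b; c] ->
  y \in [set a; b; c] -> x != y -> exists z, [set a; b; c] \subset [set x; y; z].
Proof.
move=> hx hy xy; have [z hz] : exists z, [set a; b; c] =i [set x; y; z].
  move: hx hy xy; rewrite !inE -!orbA => /or3P[] /eqP-> /or3P[] /eqP->; rewrite ?eqxx // => _;
  [exists c|exists b|exists c|exists a|exists b|exists a] => w; rewrite !inE;
  by case: (w == a); case: (w == b); case: (w == c).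
by exists z; apply/subsetP => w; rewrite hz.
Qed.

(** * Comparison of two fans *)

Section TwoFans.

Variables (V : finType) (N : V -> {set V}).
Hypothesis Nsym : forall x y, (y \in N x) = (x \in N y).
Hypothesis Nirr : forall x, x \notin N x.
Hypothesis h3 : forall S A : {set V}, #|S| < 3 -> ~~ sep N S A.

(* Otherwise {u, u'} would separate {x, y} from the other vertices. *)
Lemma two_hubs_deg3 u u' x y : 4 < #|V| -> u != u' ->
  x \in deg3nbrs N u -> x \in deg3nbrs N u' ->
  y \in deg3nbrs N u -> y \in deg3nbrs N u' -> x \in N y -> False.
Proof.
move=> hV uu' xu xu' yu yu' xy.
have [z hz] : exists z, z \notin [set x; y; u; u'].
  have [/existsP//|/existsPn h] := boolP [exists z, z \notin [set x; y; u; u']].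
  have E : [set x; y; u; u'] = setT.
    by apply/setP => z; rewrite [RHS]inE; have := h z; rewrite negbK.
  suff : #|[set x; y; u; u']| <= 4 by rewrite E cardsT leqNgt hV.
  rewrite setUC cardsU1; have := card_set3 x y u; case: (_ \notin _) => //=.
  by move/leqW.
have key a b c : a \in deg3nbrs N u -> a \in deg3nbrs N u' -> b \in deg3nbrs N u ->
    b \in deg3nbrs N u' -> b \in N a -> c \in N a -> [|| c == u, c == u' | c == b].
  move=> au au' bu bu' ba ca; apply: contraT; rewrite !negb_or => /and3P[cu cu' cb].
  have [u'a ua] : u' \in N a /\ u \in N a.
    by move: au au'; rewrite !inE => /andP[_ ->] /andP[_ ->].
  have ub : u != b by apply: contraTneq bu => <-; apply: hub_notin.
  have u'b : u' != b by apply: contraTneq bu' => <-; apply: hub_notin.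
  by case: (deg3nbrs_three au u'a ba ca) => //; rewrite // eq_sym.
apply: (@no_sep2 _ _ h3 [set x; y] u u' x z); rewrite ?inE ?eqxx //.
- move=> a b; rewrite !inE => /orP[] /eqP-> hb.
    have := key x y b xu xu' yu yu'; rewrite Nsym => /(_ xy hb).
    by case/or3P => ->; rewrite ?orbT.
  by have := key y x b yu yu' xu xu' xy hb; case/or3P => ->; rewrite ?orbT.
- by move: hz; clear; bauto.
- by move: hz; clear; bauto.
- by move: hz; clear; bauto.
Qed.

(** A wye-to-wye fan recorded by the end sets of its edges, which ignores the choice among parallel
    edges. *)
Definition fan_ends (u : V) n (v : nat -> V) : {set {set V}} :=
  [set [set u; v i.+1] | i : 'I_n] :|: [set [set v i; v i.+1] | i : 'I_n.+1].

Lemma fan_endsP u n v a b : [set a; b] \in fan_ends u n v ->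
  exists i, (0 < i <= n /\ ((a = u /\ b = v i) \/ (a = v i /\ b = u))) \/
            (i <= n /\ ((a = v i /\ b = v i.+1) \/ (a = v i.+1 /\ b = v i))).
Proof.
rewrite inE => /orP[] /imsetP[[i hi] _ /set2_eq h].
  by exists i.+1; left.
by exists i; right.
Qed.

(** The source of maximality. By [hub_deg], [u] is not on the larger rim, so different hubs would
    share the adjacent degree-3 neighbours [v 1] and [v 2]. With equal hubs the larger rim, being
    connected, cannot pass an end outside [D]; a closed rim leaves it no room to grow. *)
Lemma fan_ends_sub u n v u' n' v' :
  (forall w, w \in N u -> exists t A, sep N [set u; w; t] A) ->
  (forall x, 2 < #|N x|) -> 4 < #|V| -> 1 < n -> 0 < n' ->
  fanpath N u n v -> terminal N u n v -> fanpath N u' n' v' ->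
  fan_ends u n v \subset fan_ends u' n' v' -> u = u' /\ n = n'.
Proof.
move=> hu hdeg hV n1 n'0 hp ht hp' /subsetP hs.
have spoke i : 0 < i <= n -> [set u; v i] \in fan_ends u' n' v'.
  case: i => // i hi; apply: hs; rewrite inE; apply/orP; left.
  by apply/imsetP; exists (Ordinal hi).
have [h1 h2] : 0 < 1 <= n /\ 0 < 2 <= n by rewrite /= n1 ltnW.
have D1 := rim_deg3 hdeg hp (mem_rim v h1); have D2 := rim_deg3 hdeg hp (mem_rim v h2).
have v12 : v 1 \in N (v 2) by rewrite (fp_N hp h2) !inE eqxx orbT.
have ne12 : v 1 <> v 2 by move=> E; have [] := @fp_inj _ _ _ _ _ hp 1 2 _ E; rewrite ?h2 //; lia.
have urim : u \notin rim n' v'.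
  apply/negP => /rimP[i hi E].
  have EN := fp_N hp' hi; rewrite -E in EN.
  have u1 : v 1 \in N u by move: D1; rewrite inE Nsym => /andP[].
  have u2 : v 2 \in N u by move: D2; rewrite inE Nsym => /andP[].
  have [z hz] : exists z, N u \subset [set v 1; v 2; z].
    by rewrite EN in u1 u2 *; apply: set3_rest => //; apply/eqP.
  by have := hub_deg Nsym h3 hu hdeg z D1 D2 v12; rewrite hz.
have uu' : u = u'.
  apply/eqP/negPn/negP => uu'.
  have inK i : 0 < i <= n -> v i \in deg3nbrs N u'.
    move=> hi; apply: (rim_deg3 hdeg hp').
    have [j [[hj [[E _]|[E _]]]|[hj [[E ->]|[E ->]]]]] := fan_endsP (spoke i hi).
    - by rewrite E eqxx in uu'.
    - by rewrite E mem_rim in urim.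
    - case: j hj E => [|j] hj E; first by rewrite mem_rim.
      by rewrite E mem_rim in urim.
    - have [->|jn] := eqVneq j n'; first by rewrite mem_rim // n'0 leqnn.
      by rewrite E mem_rim // in urim; lia.
  exact: (two_hubs_deg3 hV uu' D1 (inK 1 h1) D2 (inK 2 h2)).
split=> //; subst u'.
have rsub : rim n v \subset rim n' v'.
  apply/subsetP => _ /rimP[i hi ->].
  have [j [[hj [[_ ->]|[E _]]]|[hj [[E _]|[E _]]]]] := fan_endsP (spoke i hi).
  - exact: mem_rim.
  - by have := fp_u hp' (leqW (proj2 (andP hj))); rewrite E eqxx.
  - by have := fp_u hp' (leqW hj); rewrite E eqxx.
  - by have := @fp_u _ _ _ _ _ hp' j.+1 hj; rewrite E eqxx.
have rsub' : rim n' v' \subset rim n v.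
  case: ht => [E|/andP[t0 t1]].
    have cov y : y \notin rim n v -> y != u -> y = v 0.
      by apply: (ring_cover h3) => //; rewrite ltnW.
    apply/subsetP => x xK; apply/negPn/negP => xF.
    have x0 : x = v 0.
      by apply: cov => //; apply: contraNneq urim => <-.
    have : v' 0 \in rim n' v'.
      have [|v0F] := boolP (v' 0 \in rim n v); first exact: (subsetP rsub).
      by rewrite (cov _ v0F) -?x0 // eq_sym (fp_u hp').
    by move=> /rimP[j hj E']; have [|_] := @fp_inj _ _ _ _ _ hp' 0 j _ E'; lia.
  apply/subsetP; apply: (rim_conn hp' (subsetP rsub _ (mem_rim v h1)) (mem_rim v h1)).
  move=> x y _ xF yx yK; have yD := rim_deg3 hdeg hp' yK.
  have := rim_N hp xF yx; have := hub_notin Nirr u.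
  by move: yD t0 t1; clear; bauto.
rewrite -(card_rim hp) -(card_rim hp').
by have /eqP-> : rim n v == rim n' v' by rewrite eqEsubset rsub.
Qed.

End TwoFans.

(** * Contraction *)

Lemma connect_inv (T : finType) (r : rel T) (P : pred T) x y :
  (forall a b, P a -> r a b -> P b) -> P x -> connect r x y -> P y.
Proof.
move=> hP Px /connectP[p hp ->]; elim: p x Px hp => //= z p IH x Px /andP[xz hp].
exact: IH (hP _ _ Px xz) hp.
Qed.

Lemma adjP (G : mgraph) (X : {set edge G}) x y : reflect (exists2 e, e \in X & ends e = [set x; y]) (adj X x y).
Proof.
by apply: (iffP exists_inP) => -[e eX /eqP E]; exists e => //; apply/eqP.
Qed.

Section Graphs.

Variable G : mgraph.
Implicit Types (x y z u : vert G) (e f : edge G) (H K : subgraph G) (X : {set edge G}).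

Lemma subgraph_eq H K : sV H = sV K -> sE H = sE K -> H = K.
Proof.
case: H K => [V1 E1 h1] [V2 E2 h2] /= EV EE; subst.
by congr Subgraph; exact: bool_irrelevance.
Qed.

Lemma adj_sym X : symmetric (adj X).
Proof. by move=> x y; rewrite /adj; apply: eq_existsb => e; rewrite setUC. Qed.

Lemma connect_adj_sym X x y : connect (adj X) x y = connect (adj X) y x.
Proof. exact: (sym_connect_sym (@adj_sym X)). Qed.

Lemma neighboursP x y :
  reflect (y != x /\ exists e, ends e = [set x; y]) (y \in neighbours x).
Proof.
rewrite inE; apply: (iffP andP) => -[yx h]; split=> //.
  by case/adjP: h => e _; exists e.
by case: h => e E; apply/adjP; exists e.
Qed.

Lemma neighbours_sym x y : (y \in neighbours x) = (x \in neighbours y).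
Proof. by rewrite !inE eq_sym adj_sym. Qed.

Lemma neighbours_irr x : x \notin neighbours x.
Proof. by rewrite inE eqxx. Qed.

Lemma connectedI H c :
  (forall x, x \in sV H -> connect (adj (sE H)) c x) -> connected H.
Proof.
move=> h; apply/forall_inP => x xH; apply/forall_inP => y yH.
by apply: connect_trans (h y yH); rewrite connect_adj_sym h.
Qed.

(** A boolean form of [contractible], for use in set comprehensions and minimal sets. *)
Definition cedge e : bool :=
  [forall S : {set vert (contract [set e])}, (#|S| < 3) ==>
     connected (del (whole (contract [set e])) S)].

Lemma cedgeP e : reflect (contractible e) (cedge e).
Proof.
apply: (iffP forallP) => [h S hS|h S]; first exact: (implyP (h S)).
by apply/implyP; exact: h.
Qed.

Hypothesis hG : k_connected G 3.

Lemma connected_no_sep (S A : {set vert G}) : #|S| < 3 -> ~~ sep (@neighbours G) S A.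
Proof.
move=> hS; apply/negP => /sepP[[x xA] hd hn [z /andP[zA zS]]].
have /forall_inP/(_ x) := hG hS; rewrite !inE hd // => /(_ isT)/forall_inP/(_ z).
rewrite !inE zS => /(_ isT) hc; case/negP: zA.
apply: (connect_inv (P := mem A) _ xA hc) => a b aA /adjP[e].
rewrite !inE /= => eS E.
have [->//|ba] := eqVneq b a.
have bN : b \in neighbours a by apply/neighboursP; split=> //; exists e.
have /orP[//|bS] := hn a b aA bN.
by move/disjointFr: eS => /(_ b); rewrite E !inE eqxx orbT bS => /(_ isT).
Qed.

Section Contraction.

Variables (X : {set edge G}) (U : {set vert G}) (x0 : vert G).
Hypothesis x0U : x0 \in U.
Hypothesis endsU : forall e, e \in X -> ends e \subset U.
Hypothesis connU : forall x, x \in U -> connect (adj X) x0 x.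

Lemma component_in x : x \in U -> contract_proj X x = contract_proj X x0.
Proof.
move=> xU; apply: val_inj; apply/setP => y; rewrite /= !inE.
have h := connU xU; apply/idP/idP; first exact: connect_trans.
by apply: connect_trans; rewrite connect_adj_sym.
Qed.

Lemma component_out x y : x \notin U -> contract_proj X x = contract_proj X y -> x = y.
Proof.
move=> xU /(congr1 val)/setP/(_ y); rewrite /= !inE connect0 => hc.
apply/esym/eqP; apply: (connect_inv (P := pred1 x) _ _ hc) => //=.
move=> a b /eqP-> /adjP[e eX E].
by case/negP: xU; apply: (subsetP (endsU eX)); rewrite E !inE eqxx.
Qed.

Lemma contract_projK (C : contract_vert X) : exists x, C = contract_proj X x.
Proof.
have /imsetP[x _ E] := valP C; exists x; exact: val_inj.
Qed.

(** Let [T] be the preimage of a separator. If the contracted vertex is not in the separator, [T]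
    has the same size as its image and violates 3-connectivity of [G]; otherwise [T] is [U] plus at
    most one vertex [t]. *)
Lemma contract_connected :
  (forall t A, ~~ sep (@neighbours G) (t |: U) A) -> k_connected (contract X) 3.
Proof.
move=> hno S hS; apply/forall_inP => C hC; apply/forall_inP => C' hC'.
apply: contraT => hcon.
have {hC hC'}[CS C'S] : C \notin S /\ C' \notin S.
  by move: hC hC'; rewrite !inE !andbT.
pose r := adj (sE (del (whole (contract X)) S)).
have [x1 E1] := contract_projK C; have [x2 E2] := contract_projK C'.
pose P := [set x | connect r C (contract_proj X x)].
pose T := [set x | contract_proj X x \in S].
have PT x : x \in P -> x \notin T.
  rewrite !inE => hc; apply: (connect_inv (P := [predC S]) _ _ hc) => //=.
  rewrite /r => a b _ /adjP[e]; rewrite !inE /= => eS E.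
  by move/disjointFr: eS => /(_ b); rewrite E !inE eqxx orbT => /(_ isT) ->.
have PN x y : x \in P -> y \in neighbours x -> (y \in P) || (y \in T).
  move=> xP /neighboursP[_ [e E]].
  have [//|yT] := boolP (y \in T); first by rewrite orbT.
  rewrite orbF inE; have xT := PT _ xP; rewrite inE in xP.
  have [eX|eX] := boolP (e \in X).
    have sU := subsetP (endsU eX); rewrite E in sU.
    by rewrite component_in -?(component_in (x := x)) // sU // !inE eqxx ?orbT.
  apply: connect_trans xP (connect1 _); apply/adjP.
  have Ee : contract_ends (exist _ e eX : contract_edge X) =
      [set contract_proj X x; contract_proj X y].
    by rewrite /contract_ends /= E imsetU1 imset_set1.
  exists (exist _ e eX : contract_edge X) => //.
  rewrite !inE /= Ee disjoint_subset; apply/subsetP => c; rewrite !inE => /orP[] /eqP->.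
    by move: xT; rewrite inE.
  by move: yT; rewrite inE.
have x1P : x1 \in P by rewrite inE -E1.
have x2P : x2 \notin P by rewrite inE -E2.
have x2T : x2 \notin T by rewrite inE -E2.
have hs : sep (@neighbours G) T P by apply: (sepI x1P PT PN x2P x2T).
have inj (B : {set vert G}) : [disjoint B & U] -> {in B &, injective (contract_proj X)}.
  by move=> hB x y xB _; apply: component_out; rewrite (disjointFr hB).
have imT (B : {set vert G}) : B \subset T -> contract_proj X @: B \subset S.
  move=> hB; apply/subsetP => _ /imsetP[x xB ->].
  by have := subsetP hB x xB; rewrite inE.
have [x0S|x0S] := boolP (contract_proj X x0 \in S); last first.
  have TU : [disjoint T & U].
    rewrite disjoint_subset; apply/subsetP => x; rewrite !inE.
    by apply: contraL => xU; rewrite component_in.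
  have hT : #|T| < 3.
    rewrite -(card_in_imset (inj _ TU)); apply: leq_ltn_trans hS.
    exact: subset_leq_card (imT T _).
  by have := connected_no_sep P hT; rewrite hs.
have UT : U \subset T by apply/subsetP => x xU; rewrite inE component_in.
have hT1 : #|T :\: U| <= 1.
  have dU : [disjoint T :\: U & U].
    by rewrite disjoint_subset; apply/subsetP => x; rewrite !inE => /andP[].
  rewrite -(card_in_imset (inj _ dU)).
  have : contract_proj X @: (T :\: U) \subset S :\ contract_proj X x0.
    apply/subsetP => _ /imsetP[x xTU ->]; move: xTU; rewrite !inE => /andP[xU xT].
    by rewrite xT andbT; apply: contraTneq x0U => E; rewrite -(component_out xU E).
  move/subset_leq_card/leq_trans; apply.
  by move: hS; rewrite (cardsD1 (contract_proj X x0)) x0S.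
have [t ET] : exists t, T = t |: U.
  have [E|[t tT]] := set_0Vmem (T :\: U).
    (* When [T] is just [U], a vertex of [U] serves as [t]. *)
    exists x0; rewrite (setUidPr _) ?sub1set //.
    by apply/eqP; rewrite eqEsubset UT andbT -setD_eq0 E.
  exists t; rewrite -{1}(setID T U) (setIidPr UT) setUC; congr (_ :|: _).
  apply/setP => y; rewrite [RHS]inE; apply/idP/eqP => [yT|->//].
  exact: (card_le1_eqP hT1).
by case/negP: (hno t P); rewrite -ET.
Qed.

End Contraction.

End Graphs.

(** * Fans *)

Section Fans.

Variable G : mgraph.
Implicit Types (x y z u : vert G) (e f g : edge G) (H K : subgraph G) (X : {set edge G}).
Local Notation N := (@neighbours G).

Lemma sV_induced3 e f g :
  sV (induced [set e; f; g]) = ends e :|: ends f :|: ends g.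
Proof. by rewrite /= !bigcup_setU !big_set1. Qed.

Lemma triangle_no_common e f g x : x \in ends e -> x \in ends f -> x \in ends g ->
  ~ is_triangle (induced [set e; f; g]).
Proof.
move=> xe xf xg [p [q [r [e' [f' [g' [hu _ /= EE [Ee Ef Eg]]]]]]]].
have h e1 : e1 \in [set e'; f'; g'] -> x \in ends e1.
  by rewrite -EE !inE -orbA => /or3P[] /eqP->.
have := h e'; have := h f'; have := h g'; rewrite !inE !eqxx ?orbT Ee Ef Eg !inE.
move=> /(_ isT) h1 /(_ isT) h2 /(_ isT) h3.
by move: hu; rewrite /= !inE; move: h1 h2 h3; clear; bauto.
Qed.

Lemma wye_center e f g x : x \in ends e -> x \in ends f -> x \in ends g ->
  is_wye (induced [set e; f; g]) ->
  N x = (ends e :|: ends f :|: ends g) :\ x.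
Proof.
move=> xe xf xg [c [p [q [r [e' [f' [g' [hu EV /= EE [Ee Ef Eg] EN]]]]]]]].
have h e1 : e1 \in [set e'; f'; g'] -> x \in ends e1.
  by rewrite -EE !inE -orbA => /or3P[] /eqP->.
have hx : x = c.
  have := h e'; have := h f'; have := h g'; rewrite !inE !eqxx ?orbT Ee Ef Eg !inE.
  move=> /(_ isT) h1 /(_ isT) h2 /(_ isT) h3; apply/eqP.
  by move: hu; rewrite /= !inE; move: h1 h2 h3; clear; bauto.
rewrite -sV_induced3 EV hx EN; apply/setP => z; rewrite !inE.
move: hu; rewrite /= !inE !negb_or => /and4P[/and3P[cp cq cr] _ _ _].
have [->|//] := eqVneq z c; by rewrite (negPf cp) (negPf cq) (negPf cr).
Qed.

(** The three edges around a spoke share its rim end, so they form no triangle; being a wye, they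
    determine all neighbours of that end. *)
Lemma wye_to_wye_fanpath K n a : wye_to_wye_ordering K n a ->
  exists u v, [/\ 0 < n, fanpath N u n v,
    forall i, 0 < i <= n -> ends (a i.*2.-1) = [set u; v i],
    forall i, i <= n -> ends (a i.*2) = [set v i; v i.+1]
    & K = induced [set a i | i : 'I_n.*2.+1]].
Proof.
move=> [n0 [_ _ EK _ [htr _]] [u [v [hy hx hu hi]]]]; exists u, v; split=> //; last first.
  by rewrite EK; have -> : n.*2.-1.+2 = n.*2.+1 by lia.
split=> // -[//|i] hin.
have e1 : ends (a i.*2.+1) = [set u; v i.+1] by rewrite -(hy i.+1).
have e0 : ends (a i.*2) = [set v i; v i.+1] by rewrite hx //; lia.
have e2 : ends (a i.*2.+2) = [set v i.+1; v i.+2] by rewrite -hx //; lia.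
have [|hw|ht] := htr i.*2.+1; first by lia.
- rewrite (wye_center _ _ _ hw) ?e0 ?e1 ?e2 ?inE ?eqxx ?orbT //=.
  apply/setP => z; rewrite !inE.
  have [->|zv] := eqVneq z (v i.+1); last first.
    by case: (z == u); case: (z == v i); case: (z == v i.+2).
  rewrite /= [_ == u]eq_sym (negPf (hu _ _)) /=; last by lia.
  symmetry; apply/norP; split; apply/eqP => E.
    by have [|] := hi i i.+1 _ (esym E); lia.
  by have [|] := hi i.+1 i.+2 _ E; lia.
- by case: (triangle_no_common _ _ _ ht (x := v i.+1)); rewrite ?e0 ?e1 ?e2 !inE eqxx ?orbT.
Qed.

(* The ends of the edge a_k in the ordering x_0, y_1, x_1, ..., y_n, x_n. *)
Definition fan_end u (v : nat -> vert G) k : {set vert G} :=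
  if odd k then [set u; v k./2.+1] else [set v k./2; v k./2.+1].

Section Construction.

Variables (u : vert G) (n : nat) (v : nat -> vert G).
Hypothesis hp : fanpath N u n v.
Hypothesis n1 : 1 < n.
Hypothesis hdeg : forall x, 2 < #|N x|.

Lemma fan_end_inj j k : j <= n.*2 -> k <= n.*2 -> fan_end u v j = fan_end u v k -> j = k.
Proof.
have hodd j' : odd j' -> j' <= n.*2 -> j'./2.+1 <= n by lia.
have half j' : j'./2 <= n -> j'./2.+1 <= n.+1 by lia.
have heven j' : j' <= n.*2 -> j'./2 <= n by lia.
have vv i i' : i < i' <= n -> [set v i; v i.+1] = [set v i'; v i'.+1] -> False.
  move=> hi /set2_eq[[E _]|[E E']].
    by have [|] := @fp_inj _ _ _ _ _ hp i i' _ E; lia.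
  (* Consecutive rim edges with the same ends would mean [v 0 = v 2] and [n = 1], which [n1]
     excludes. *)
  have [E1|ne] := eqVneq i' i.+1; last first.
    by have [|] := @fp_inj _ _ _ _ _ hp i.+1 i' _ E'; lia.
  by have [|] := @fp_inj _ _ _ _ _ hp i i'.+1 _ E; lia.
have uv j' k' : odd j' -> ~~ odd k' -> j' <= n.*2 -> k' <= n.*2 -> fan_end u v j' <> fan_end u v k'.
  move=> oj ok hj hk; rewrite /fan_end oj (negPf ok) => /set2_eq[] [E _].
    by have := fp_u hp (leqW (heven _ hk)); rewrite E eqxx.
  by have := fp_u hp (half _ (heven _ hk)); rewrite E eqxx.
move=> hj hk; have [oj|ej] := boolP (odd j); have [ok|ek] := boolP (odd k).
- rewrite /fan_end oj ok => /set2_eq[[_ E]|[E _]]; last first.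
    by have := fp_u hp (leqW (hodd _ ok hk)); rewrite E eqxx.
  case: (ltngtP j./2 k./2) => h; last by lia.
    by have [|] := @fp_inj _ _ _ _ _ hp j./2.+1 k./2.+1 _ E; have := hodd _ ok hk; lia.
  by have [|] := @fp_inj _ _ _ _ _ hp k./2.+1 j./2.+1 _ (esym E); have := hodd _ oj hj; lia.
- by move=> E; case: (uv j k).
- by move=> E; case: (uv k j).
- rewrite /fan_end (negPf ej) (negPf ek) => E.
  case: (ltngtP j./2 k./2) => h; last by lia.
    by case: (vv _ _ _ E); have := heven _ hk; lia.
  by case: (vv _ _ _ (esym E)); have := heven _ hj; lia.
Qed.

Lemma spoke_neighbour i : 0 < i <= n -> u \in N (v i).
Proof. by move=> hi; rewrite (fp_N hp hi) !inE eqxx. Qed.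

Lemma rim_neighbour i : i <= n -> v i.+1 \in N (v i).
Proof.
move=> hi; have [i0|ip] := posnP i; last by rewrite (fp_N hp) ?ip // !inE eqxx orbT.
(* The neighbours of [v 0] are unknown, so this edge is seen from [v 1]. *)
by rewrite i0 neighbours_sym (fp_N hp) ?(ltnW n1) // !inE eqxx orbT.
Qed.

Lemma fan_edges : exists a : nat -> edge G, forall k, k <= n.*2 -> ends (a k) = fan_end u v k.
Proof.
have ex k : k <= n.*2 -> exists e, ends e == fan_end u v k.
  move=> hk; rewrite /fan_end; case: ifP => ok.
    have hk' : 0 < k./2.+1 <= n by lia.
    have /neighboursP[_ [e E]] := spoke_neighbour hk'.
    by exists e; rewrite E setUC.
  have hk' : k./2 <= n by lia.
  by have /neighboursP[_ [e E]] := rim_neighbour hk'; exists e; rewrite E.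
have [e0 _] := ex 0 (leq0n _).
(* [e0] is a dummy value for indices beyond the fan. *)
exists (fun k => odflt e0 [pick e | ends e == fan_end u v k]) => k /ex[e E].
by case: pickP => [e' /eqP//|/(_ e)]; rewrite E.
Qed.

Variable a : nat -> edge G.
Hypothesis ha : forall k, k <= n.*2 -> ends (a k) = fan_end u v k.

Lemma fan_edge_inj j k : j <= n.*2 -> k <= n.*2 -> a j = a k -> j = k.
Proof. by move=> hj hk E; apply: fan_end_inj => //; rewrite -!ha // E. Qed.

Lemma ends_spoke i : 0 < i <= n -> ends (a i.*2.-1) = [set u; v i].
Proof.
case: i => // i hi; rewrite ha; last by lia.
by rewrite /fan_end doubleS /= odd_double /= uphalf_double.
Qed.

Lemma ends_rim i : i <= n -> ends (a i.*2) = [set v i; v i.+1].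
Proof. by move=> hi; rewrite ha ?leq_double // /fan_end odd_double doubleK. Qed.

Lemma fan_wye i : i < n -> is_wye (triple a i.*2.+1).
Proof.
move=> hi; have hi' : 0 < i.+1 <= n by rewrite hi.
have e1 := ends_spoke hi'; have e0 := ends_rim (ltnW hi); have e2 := ends_rim hi.
rewrite doubleS /= in e1 e2.
have hN := fp_N hp hi'; rewrite /= in hN.
have := hdeg (v i.+1); rewrite hN => hc.
have vv : v i != v i.+2.
  by apply: contraTneq hc => ->; rewrite -setUA setUid cards2; case: eqP.
have vi : v i.+1 \notin [set u; v i; v i.+2] by rewrite -hN; exact: neighbours_irr.
have u1 : u != v i by apply: (fp_u hp); lia.
have u2 : u != v i.+2 by apply: (fp_u hp); lia.
exists (v i.+1), u, (v i), (v i.+2), (a i.*2.+1), (a i.*2), (a i.*2.+2); split=> //.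
- rewrite /= !inE !negb_or u1 u2 vv /= !andbT.
  by move: vi; rewrite !inE !negb_or -andbA.
- rewrite sV_induced3 e0 e1 e2; apply/setP => z; rewrite !inE.
  by case: (z == u); case: (z == v i); case: (z == v i.+1); case: (z == v i.+2).
- by apply/setP => z; rewrite !inE; case: (z == a i.*2); case: (z == a i.*2.+1).
- by split; rewrite ?e0 ?e1 ?e2 // setUC.
Qed.

Lemma fan_triangle i : 0 < i < n -> is_triangle (triple a i.*2).
Proof.
case: i => // i hi; have hi' : 0 < i.+1 <= n by lia.
have hi2 : 0 < i.+2 <= n by lia.
have e1 := ends_spoke hi'; have e0 := ends_rim (proj2 (andP hi')); have e2 := ends_spoke hi2.
rewrite !doubleS /= in e0 e1 e2 *.
exists u, (v i.+1), (v i.+2), (a i.*2.+1), (a i.*2.+2), (a i.*2.+3); split=> //.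
- rewrite /= !inE !negb_or !(fp_u hp) /= ?andbT; try lia.
  have := rim_neighbour (proj2 (andP hi')); apply: contraTneq => <-.
  exact: neighbours_irr.
- rewrite sV_induced3 e0 e1 e2; apply/setP => z; rewrite !inE.
  by case: (z == u); case: (z == v i.+1); case: (z == v i.+2).
Qed.

Lemma fan_not_triangle i : i < n -> ~ is_triangle (triple a i.*2.+1).
Proof.
move=> hi; have hi' : 0 < i.+1 <= n by rewrite hi.
have e1 := ends_spoke hi'; have e0 := ends_rim (ltnW hi); have e2 := ends_rim hi.
rewrite doubleS /= in e1 e2.
by apply: (triangle_no_common (x := v i.+1)); rewrite ?e0 ?e1 ?e2 !inE eqxx ?orbT.
Qed.

Lemma wye_not_triangle H : is_wye H -> is_triangle H -> False.
Proof.
move=> [c [p [q [r [e [f [g [hu EV _ _ _]]]]]]]] [p' [q' [r' [e' [f' [g' [_ EV' _ _]]]]]]].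
have := card_set3 p' q' r'; rewrite -EV' EV leqNgt => /negP[].
have -> : [set c; p; q; r] = [set x in [:: c; p; q; r]].
  by apply/setP => z; rewrite !inE -!orbA.
by rewrite cardsE (card_uniqP hu).
Qed.

Definition outer_fan : subgraph G := induced [set a i | i : 'I_n.*2.+1].

Lemma mem_outer k : k <= n.*2 -> a k \in sE outer_fan.
Proof. by move=> hk; apply/imsetP; exists (Ordinal (hk : k < n.*2.+1)). Qed.

Lemma outerP e : e \in sE outer_fan -> exists2 k, k <= n.*2 & e = a k.
Proof. by move=> /imsetP[k _ ->]; exists k; rewrite // -ltnS. Qed.

Lemma fan_end_card k : k <= n.*2 -> #|fan_end u v k| = 2.
Proof.
move=> hk; rewrite /fan_end; case: ifP => ok; rewrite cards2.
  by rewrite (fp_u hp) //; lia.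
rewrite (_ : v k./2 != _) //.
have hk' : k./2 <= n by lia.
have := rim_neighbour hk'; apply: contraTneq => <-; exact: neighbours_irr.
Qed.

(** Odd positions are spokes and centre wyes; even positions strictly inside are rim edges and
    centre triangles. *)
Lemma outer_ordering : wye_to_wye_ordering outer_fan n a.
Proof.
split; first exact: ltnW.
  split.
  - by lia.
  - split.
      by move=> e /outerP[k hk ->]; rewrite ha // fan_end_card.
    move=> e f /outerP[j hj ->] /outerP[k hk ->]; rewrite !ha // => E.
    by rewrite (fan_end_inj hj hk E).
  - by rewrite /outer_fan; have -> : n.*2.-1.+2 = n.*2.+1 by lia.
  - by move=> i j hi hj; apply: fan_edge_inj; lia.
  - split.
      move=> i hi; have [oi|ei] := boolP (odd i).
        by left; rewrite (_ : i = i./2.*2.+1); [apply: fan_wye; lia|lia].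
      by right; rewrite (_ : i = i./2.*2); [apply: fan_triangle; lia|lia].
    move=> i hi; have [oi|ei] := boolP (odd i).
      rewrite (_ : i = i./2.*2.+1); last by lia.
      split=> _; last by apply: fan_wye; lia.
      by rewrite -doubleS; apply: fan_triangle; lia.
    rewrite (_ : i = i./2.*2); last by lia.
    split=> [hw|ht].
      by case: (wye_not_triangle hw); apply: fan_triangle; lia.
    by case: (fan_not_triangle _ ht); lia.
exists u, v; split.
- exact: ends_spoke.
- exact: ends_rim.
- by move=> i hi; apply: (fp_u hp).
- exact: (fp_inj hp).
Qed.

Lemma fan_ends_outer S : S \in fan_ends u n v -> exists2 k, k <= n.*2 & ends (a k) = S.
Proof.
rewrite inE => /orP[] /imsetP[[i hi] _ ->] /=.
  by exists i.+1.*2.-1; [lia|rewrite ends_spoke].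
by exists i.*2; [lia|rewrite ends_rim].
Qed.

End Construction.

End Fans.

(** * Inner fans at uncovered vertices *)

Section InnerFans.

Variable G : mgraph.
Implicit Types (x y z u : vert G) (e f g : edge G) (H K : subgraph G) (X : {set edge G}).
Local Notation N := (@neighbours G).
Hypothesis hG : k_connected G 3.

Let Nsym := @neighbours_sym G.
Let Nirr := @neighbours_irr G.
Let h3 := connected_no_sep hG.

Lemma contractible_no_sep e x y : ends e = [set x; y] ->
  (forall t A, ~~ sep N [set x; y; t] A) -> contractible e.
Proof.
move=> E hno; have xy : x \in [set x; y] by rewrite !inE eqxx.
apply: (contract_connected hG xy).
- by move=> f; rewrite inE => /eqP->; rewrite E.
- move=> z; rewrite !inE => /orP[] /eqP->; first exact: connect0.
  by apply: connect1; apply/adjP; exists e; rewrite ?inE.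
- by move=> t A; rewrite setUC.
Qed.

Section Hub.

Variables (u : vert G) (n : nat) (v : nat -> vert G) (a : nat -> edge G).
Hypothesis hu : forall w, w \in N u -> exists t A, sep N [set u; w; t] A.
Hypothesis hdeg : forall x, 2 < #|N x|.
Hypothesis hV : 4 < #|vert G|.
Hypothesis hp : fanpath N u n v.
Hypothesis ht : terminal N u n v.
Hypothesis n1 : 1 < n.
Hypothesis hno : forall t A, ~~ sep N (t |: (u |: rim n v)) A.
Hypothesis ha : forall k, k <= n.*2 -> ends (a k) = fan_end u v k.

(** By [fan_ends_sub] a larger fan has the same [n], hence the same number of edges. *)
Lemma outer_maximal : maximal_wye_to_wye_fan (outer_fan n a).
Proof.
split; first by exists n, a; exact: (outer_ordering hp n1 hdeg ha).
move=> K [n' [a' /wye_to_wye_fanpath[u' [v' [n0' hp' hy hx EK]]]]] /andP[_ /subsetP hs].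
have hfe : fan_ends u n v \subset fan_ends u' n' v'.
  apply/subsetP => S /(fan_ends_outer n1 ha)[k hk <-].
  have := hs _ (mem_outer a hk); rewrite EK => /imsetP[[j hj] _ ->] /=.
  rewrite inE; have [oj|ej] := boolP (odd j).
    have hj' : j./2 < n' by lia.
    apply/orP; left; apply/imsetP; exists (Ordinal hj') => //=.
    by rewrite -hy /=; [congr (ends (a' _)); lia|lia].
  have hj' : j./2 < n'.+1 by lia.
  apply/orP; right; apply/imsetP; exists (Ordinal hj') => //=.
  by rewrite -hx /=; [congr (ends (a' _)); lia|lia].
have [_ nn'] := fan_ends_sub Nsym Nirr h3 hu hdeg hV n1 n0' hp ht hp' hfe.
suff EE : [set a i | i : 'I_n.*2.+1] = [set a' i | i : 'I_n'.*2.+1].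
  by rewrite EK /outer_fan EE.
apply/eqP; rewrite eqEcard; apply/andP; split.
  by apply/subsetP => e he; have := hs e he; rewrite EK.
rewrite -nn' [X in _ <= X]card_imset; first exact: leq_trans (leq_imset_card _ _) _.
move=> [i hi] [j hj] /= E; apply: val_inj => /=.
by apply: (fan_edge_inj hp n1 ha).
Qed.

Definition inner_edges : {set edge G} := [set a i.+1 | i : 'I_n.*2.-1].

Lemma mem_inner k : 0 < k < n.*2 -> a k \in inner_edges.
Proof.
case: k => // k hk; apply/imsetP.
have hk' : k < n.*2.-1 by lia.
by exists (Ordinal hk').
Qed.

Lemma innerP e : e \in inner_edges -> exists2 k, 0 < k < n.*2 & e = a k.
Proof. by move=> /imsetP[[k hk] _ ->]; exists k.+1 => //=; lia. Qed.

Lemma inner_ends k : 0 < k < n.*2 -> ends (a k) \subset u |: rim n v.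
Proof.
move=> hk; rewrite ha; last by lia.
rewrite /fan_end; have [ok|ek] := boolP (odd k).
  apply/subsetP => x; rewrite !inE => /orP[->//|/eqP->].
  by rewrite mem_rim ?orbT //; lia.
by apply/subsetP => x; rewrite !inE => /orP[] /eqP->; rewrite mem_rim ?orbT //; lia.
Qed.

Lemma inner_spoke i : 0 < i <= n -> exists2 e, e \in inner_edges & ends e = [set u; v i].
Proof.
move=> hi; exists (a i.*2.-1); last exact: (ends_spoke n1 ha hi).
by apply: mem_inner; lia.
Qed.

Lemma inner_rim i : 0 < i < n -> exists2 e, e \in inner_edges & ends e = [set v i; v i.+1].
Proof.
move=> hi; exists (a i.*2); last by apply: (ends_rim ha); lia.
by apply: mem_inner; lia.
Qed.

Lemma inner_vertices : sV (induced inner_edges) = u |: rim n v.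
Proof.
apply/eqP; rewrite eqEsubset; apply/andP; split.
  by apply/bigcupsP => e /innerP[k hk ->]; exact: inner_ends.
have spoke i x : 0 < i <= n -> x \in [set u; v i] -> x \in sV (induced inner_edges).
  by move=> /inner_spoke[e eX E] hx; apply/bigcupP; exists e => //; rewrite E.
apply/subsetP => x; rewrite in_setU1 => /orP[/eqP->|/rimP[i hi ->]].
  by apply: (spoke 1); rewrite ?inE ?eqxx //; lia.
by apply: (spoke i) => //; rewrite !inE eqxx orbT.
Qed.

Lemma inner_is_inner_fan : inner_fan (induced inner_edges).
Proof.
exists (outer_fan n a), n, a; split=> //.
- exact: outer_maximal.
- exact: (outer_ordering hp n1 hdeg ha).
apply: (contract_connected hG (setU11 u (rim n v))) => //.
- by move=> e /innerP[k hk ->]; exact: inner_ends.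
- move=> x; rewrite in_setU1 => /orP[/eqP->|/rimP[i hi ->]]; first exact: connect0.
  have [e eX E] := inner_spoke hi.
  by apply: connect1; apply/adjP; exists e.
Qed.

(** After deleting a rim vertex the hub still joins everything; after deleting the hub the rim path
    does. *)
Lemma inner_nonseparable : nonseparable (induced inner_edges).
Proof.
have un i : 0 < i <= n -> u != v i by move=> hi; apply: (fp_u hp); lia.
have toU (S : {set vert G}) i : u \notin S -> 0 < i <= n -> v i \notin S ->
    connect (adj (sE (del (induced inner_edges) S))) u (v i).
  move=> uS hi iS; have [e eX E] := inner_spoke hi.
  apply: connect1; apply/adjP; exists e => //; rewrite inE eX /= E.
  rewrite disjoint_subset; apply/subsetP => x; rewrite !inE.
  by case/orP => /eqP->.
split.
  apply: (@connectedI _ _ u) => x; rewrite inner_vertices in_setU1.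
  case/orP => [/eqP->|/rimP[i hi ->]]; first exact: connect0.
  by have [e eX E] := inner_spoke hi; apply: connect1; apply/adjP; exists e.
move=> x; apply/negP => /andP[]; rewrite inner_vertices in_setU1.
have [->|xu] := eqVneq x u; move=> hx; apply/negP; rewrite negbK.
  apply: (@connectedI _ _ (v 1)) => y; rewrite in_setD inner_vertices in_setU1 in_set1.
  case/andP => /negPf-> /= /rimP[i hi ->]; elim: i hi => // i IH hi.
  have [->|i0] := posnP i; first exact: connect0.
  have hi' : 0 < i < n by lia.
  apply: connect_trans (IH _) _; first by lia.
  have [e eX E] := inner_rim hi'.
  apply: connect1; apply/adjP; exists e => //; rewrite inE eX /= E.
  rewrite disjoint_subset; apply/subsetP => z; rewrite !inE.
  by case/orP => /eqP->; rewrite eq_sym un //; lia.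
apply: (@connectedI _ _ u) => y; rewrite in_setD inner_vertices in_setU1 in_set1.
case/andP => yx /orP[/eqP->|/rimP[i hi E]]; first exact: connect0.
by rewrite E; apply: toU; rewrite ?inE // -?E // eq_sym.
Qed.

Lemma inner_no_loop e : e \in inner_edges -> #|ends e| = 2.
Proof.
move=> /innerP[k hk ->]; rewrite ha; last by lia.
by apply: (fan_end_card hp n1); lia.
Qed.

(** Since [n1] holds, every rim vertex has a neighbour on the rim. In particular rim vertices are
    covered, so they are never hubs. *)
Lemma rim_contractible x : x \in rim n v ->
  exists2 y, y \in rim n v & y \in N x /\ exists2 e, contractible e & ends e = [set x; y].
Proof.
have adjc y z : y \in rim n v -> z \in rim n v -> z \in N y ->
    z \in N y /\ exists2 e, contractible e & ends e = [set y; z].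
  move=> yR zR yz; split=> //; have /neighboursP[_ [e E]] := yz.
  exists e => //; apply: (contractible_no_sep E) => t A.
  have D := @rim_deg3 _ _ _ hdeg _ _ _ hp.
  by apply: (deg3_edge_no_sep Nsym Nirr h3 hu hdeg t A (D _ yR) (D _ zR)); rewrite Nsym.
move=> /rimP[i hi ->]; have [ilt|ige] := ltnP i n.
  exists (v i.+1); first by apply: mem_rim; lia.
  by apply: adjc; rewrite ?mem_rim ?(fp_N hp hi) ?inE ?eqxx ?orbT //; lia.
exists (v i.-1); first by apply: mem_rim; lia.
by apply: adjc; rewrite ?mem_rim ?(fp_N hp hi) ?inE ?eqxx ?orbT //; lia.
Qed.

End Hub.

Definition uncovered : {set vert G} :=
  [set x | [forall e, cedge e && (#|ends e| == 2) ==> (x \notin ends e)]].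

Lemma covered_edge x : x \notin uncovered ->
  exists2 e, contractible e & #|ends e| = 2 /\ x \in ends e.
Proof.
rewrite inE negb_forall => /existsP[e]; rewrite negb_imply negbK.
by case/andP=> /andP[/cedgeP he /eqP h2] xe; exists e.
Qed.

Lemma uncoveredE x y e : contractible e -> ends e = [set x; y] -> x != y ->
  (x \notin uncovered) && (y \notin uncovered).
Proof.
move=> /cedgeP he E xy; rewrite !inE !negb_forall.
by apply/andP; split; apply/existsP; exists e; rewrite negb_imply negbK he E cards2 xy !inE eqxx ?orbT.
Qed.

Lemma uncovered_sep u w : u \in uncovered -> w \in N u ->
  exists t A, sep N [set u; w; t] A.
Proof.
move=> uU /neighboursP[wu [e E]].
have [/existsP[t /existsP[A hs]]|/existsPn hno] :=
  boolP [exists t, exists A, sep N [set u; w; t] A]; first by exists t, A.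
have /andP[] : (u \notin uncovered) && (w \notin uncovered).
  apply: (uncoveredE _ E); last by rewrite eq_sym.
  apply: (contractible_no_sep E) => t A.
  by have := hno t; rewrite negb_exists => /forallP.
by rewrite uU.
Qed.

(** Forgets the path and keeps what disjointness and the block argument use. *)
Record hub_inner_fan u X (Q : {set vert G}) : Prop := HubInnerFan {
  hf_inner : inner_fan (induced X);
  hf_nonsep : nonseparable (induced X);
  hf_vert : sV (induced X) = u |: Q;
  hf_loop : forall e, e \in X -> #|ends e| = 2;
  hf_deg : forall x, x \in Q -> x \in deg3nbrs N u;
  hf_cov : forall x, x \in Q -> exists2 y, y \in Q &
    [/\ y \in N x, x \notin uncovered & y \notin uncovered] }.

Hypothesis hV2 : forall x, exists y, y != x.

Lemma uncovered_neighbour u : exists w, w \in N u.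
Proof.
have [E|[w hw]] := set_0Vmem (N u); last by exists w.
have [z zu] := hV2 u.
case: (@no_sep2 _ _ h3 [set u] u u u z); rewrite ?inE //.
by move=> x y; rewrite in_set1 => /eqP->; rewrite E in_set0.
Qed.

Lemma uncovered_card u : u \in uncovered -> 4 < #|vert G|.
Proof.
move=> uU; have [w hw] := uncovered_neighbour u.
by apply: (card_gt4 h3 _ hw) => w'; apply: uncovered_sep.
Qed.

Lemma uncovered_hub u : u \in uncovered -> exists XQ, hub_inner_fan u XQ.1 XQ.2.
Proof.
move=> uU; have hV := uncovered_card uU.
have hu w : w \in N u -> exists t A, sep N [set u; w; t] A by apply: uncovered_sep.
have hdeg x : 2 < #|N x| by apply: (deg_ge3 Nirr h3); apply: ltnW.
have [w hw] := uncovered_neighbour u.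
have [n [v [n0 hp ht hno]]] := hub_fan Nsym Nirr h3 hu hdeg hw.
have n1 := no_sep_size Nsym hu hdeg n0 hp hno.
have [a ha] := fan_edges hp n1.
exists (inner_edges n a, rim n v); split=> /=.
- exact: inner_is_inner_fan hu hdeg hV hp ht n1 hno ha.
- exact: inner_nonseparable hp n1 ha.
- exact: inner_vertices n1 ha.
- by move=> e; apply: inner_no_loop hp n1 ha e.
- by move=> x; apply: rim_deg3.
- move=> x /(rim_contractible hu hdeg hV hp n1)[y yR [yx [e he E]]]; exists y => //.
  have xy : x != y by apply: contraTneq yx => ->; exact: Nirr.
  by have /andP[] := uncoveredE he E xy.
Qed.

(** Hubs are uncovered and rim vertices covered, so a common vertex [x] lies on both rims. It has
    degree 3 and both hubs as neighbours, so its neighbours on the two rims coincide, which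
    [two_hubs_deg3] forbids. *)
Lemma hub_fans_disjoint u u' X X' Q Q' : u \in uncovered -> u' \in uncovered ->
  u != u' -> hub_inner_fan u X Q -> hub_inner_fan u' X' Q' -> [disjoint u |: Q & u' |: Q'].
Proof.
move=> uU uU' uu' hf hf'; rewrite disjoint_subset; apply/subsetP => x.
rewrite in_setU1 inE in_setU1 => hx; apply/negP => hx'.
have cov y : y \in Q -> y \notin uncovered by case/(hf_cov hf) => z _ [].
have cov' y : y \in Q' -> y \notin uncovered by case/(hf_cov hf') => z _ [].
case/orP: hx => [/eqP E|xQ]; case/orP: hx' => [/eqP E'|xQ'].
- by rewrite -E -E' eqxx in uu'.
- by have := cov' _ xQ'; rewrite E uU.
- by have := cov _ xQ; rewrite E' uU'.
have [y yQ [yx _ yU]] := hf_cov hf xQ; have [y' yQ' [yx' _ yU']] := hf_cov hf' xQ'.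
have neU z w : z \in uncovered -> w \notin uncovered -> z != w.
  by move=> zU; apply: contraNneq => <-.
have D := hf_deg hf xQ; have D' := hf_deg hf' xQ'.
have u'x : u' \in N x by move: D'; rewrite inE => /andP[].
have yy' : y = y'.
  apply/eqP/negPn/negP => yy'.
  by apply: (deg3nbrs_three D u'x yx yx') => //; apply: neU.
subst y'; apply: (two_hubs_deg3 Nsym Nirr h3 (uncovered_card uU) uu' D D' (hf_deg hf yQ) (hf_deg hf' yQ')).
by rewrite Nsym.
Qed.

End InnerFans.

(** * Blocks *)

Section Blocks.

Variable G : mgraph.
Implicit Types (x y z u : vert G) (e f g : edge G) (B H K : subgraph G) (X : {set edge G}).

Lemma subgraph_ends H e : e \in sE H -> ends e \subset sV H.
Proof. by case: H => V E /= /forall_inP; apply. Qed.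

Lemma connected_trivial H : {in sV H &, forall x y, x = y} -> connected H.
Proof.
move=> h; apply/forall_inP => x xH; apply/forall_inP => y yH.
by rewrite (h x y xH yH) connect0.
Qed.

Lemma ends2 e x : #|ends e| = 2 -> x \in ends e -> exists2 w, w != x & ends e = [set x; w].
Proof.
move=> h2 xe; have /cards1P[w E] : #|ends e :\ x| == 1.
  by move: h2; rewrite (cardsD1 x) xe add1n => -[->].
have : w \in ends e :\ x by rewrite E inE.
by rewrite !inE => /andP[wx _]; exists w; rewrite // -E setD1K.
Qed.

Lemma edge_nonseparable e : #|ends e| = 2 -> nonseparable (induced [set e]).
Proof.
move=> h2; have /set0Pn[x xe] : ends e != set0 by rewrite -card_gt0 h2.
have [w wx E] := ends2 h2 xe.
have EV : sV (induced [set e]) = [set x; w] by rewrite /= big_set1 E.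
split.
  apply: (@connectedI _ _ x) => y; rewrite EV !inE => /orP[] /eqP->; first exact: connect0.
  by apply: connect1; apply/adjP; exists e; rewrite ?inE.
move=> c; apply/negP => /andP[]; rewrite EV => hc; apply/negP; rewrite negbK.
apply: connected_trivial => y z; rewrite !in_setD EV !inE.
by move: hc; rewrite !inE; case/orP => /eqP-> /andP[yc hy] /andP[zc hz];
  move: hy hz; rewrite ?(negPf yc) ?(negPf zc) ?orbF => /eqP-> /eqP->.
Qed.

Variables (I : {set vert G}) (W : vert G -> {set vert G}) (X : vert G -> {set edge G}).
Variable (D : {set edge G}).
Hypothesis WX : forall u, u \in I -> sV (induced (X u)) = W u.
Hypothesis Xnonsep : forall u, u \in I -> nonseparable (induced (X u)).
Hypothesis Xloop : forall u e, u \in I -> e \in X u -> #|ends e| = 2.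
Hypothesis Wdisj : forall u u', u \in I -> u' \in I -> u != u' -> [disjoint W u & W u'].
Hypothesis Dloop : forall e, e \in D -> #|ends e| = 2.
Hypothesis Dcover : forall x, (forall u, u \in I -> x \notin W u) ->
  exists2 e, e \in D & x \in ends e.
Hypothesis Dprivate : forall e, e \in D -> exists2 p, p \in ends e &
  (forall u, u \in I -> p \notin W u) /\ (forall f, f \in D -> p \in ends f -> f = e).

Fact spanning_subproof :
  [forall e in (\bigcup_(u in I) X u) :|: D, ends e \subset [set: vert G]].
Proof. by apply/forall_inP => e _; exact: subsetT. Qed.

Definition spanning : subgraph G := Subgraph spanning_subproof.

Lemma X_ends u e : u \in I -> e \in X u -> ends e \subset W u.
Proof. by move=> uI eX; rewrite -WX //; apply: subgraph_ends. Qed.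

Lemma W_uniq u u' x : u \in I -> u' \in I -> x \in W u -> x \in W u' -> u = u'.
Proof.
move=> uI uI' xu xu'; apply/eqP; apply: contraTT xu' => h.
by rewrite (disjointFr (Wdisj uI uI' h) xu).
Qed.

(** A private end is on one edge only, so in a block containing this edge a third vertex would make
    the other end a cut vertex. A block without edges of [D] cannot pass between different [W u], as
    these are disjoint. *)
Lemma spanning_block B (x0 : vert G) : block spanning B ->
  (exists2 u, u \in I & B = induced (X u)) \/ (exists2 e, e \in D & B = induced [set e]).
Proof.
move=> [/andP[_ /subsetP BF] [Bc Bcut] Bmax].
have BFE e : e \in sE B -> (exists2 u, u \in I & e \in X u) \/ e \in D.
  by move=> /BF; rewrite !inE => /orP[/bigcupP[u uI eX]|eD]; [left; exists u|right].
have F2 e : e \in sE B -> #|ends e| = 2.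
  by case/BFE => [[u uI eX]|/Dloop//]; exact: Xloop eX.
have [/exists_inP[e eB eD]|/exists_inPn noD] := boolP [exists e in sE B, e \in D].
  right; exists e => //.
  have [p pe [pW pD]] := Dprivate eD.
  have [w wp E] := ends2 (Dloop eD) pe.
  have only f : f \in sE B -> p \in ends f -> f = e.
    case/BFE => [[u uI fX] pf|]; last exact: pD.
    by case/negP: (pW u uI); apply: (subsetP (X_ends uI fX)).
  have eV := subsetP (subgraph_ends eB); rewrite E in eV.
  have [pV wV] : p \in sV B /\ w \in sV B by split; apply: eV; rewrite !inE eqxx ?orbT.
  have hV x : x \in sV B -> (x == p) || (x == w).
    move=> xV; have [//|xw] := eqVneq x w; first by rewrite orbT.
    rewrite orbF; have := Bcut w; rewrite /cut_vertex wV negbK.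
    move=> /forall_inP/(_ p); rewrite in_setD in_set1 eq_sym wp pV => /(_ isT).
    move=> /forall_inP/(_ x); rewrite in_setD in_set1 xw xV => /(_ isT) hc.
    apply: (connect_inv (P := pred1 p) _ _ hc); rewrite /= ?eqxx // => a b /eqP-> /adjP[f].
    rewrite inE => /andP[fB fw] Ef.
    have fe : f = e by apply: only; rewrite // Ef !inE eqxx.
    by move/disjointFr: fw => /(_ w); rewrite fe E !inE eqxx orbT => /(_ isT).
  have EV : sV B = [set p; w].
    by apply/setP => x; rewrite !inE; apply/idP/orP => [/hV/orP//|[] /eqP->].
  apply: subgraph_eq => /=; first by rewrite big_set1 E.
  apply/setP => f; rewrite inE; apply/idP/eqP => [fB|->//].
  have Ef : ends f = [set p; w].
    by apply/eqP; rewrite eqEcard -{1}EV subgraph_ends // F2 // cards2; case: eqP.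
  by apply: only; rewrite // Ef !inE eqxx.
have hx0 : exists x, forall y, y \in sV B -> connect (adj (sE B)) x y.
  (* [x0] is a default for a block without vertices. *)
  have [E|[x xV]] := set_0Vmem (sV B); first by exists x0 => y; rewrite E inE.
  by exists x => y yV; move/forall_inP: Bc => /(_ x xV)/forall_inP; apply.
have {hx0}[x hx] := hx0.
have BX e : e \in sE B -> exists2 u, u \in I & e \in X u.
  by move=> eB; case: (BFE e eB) => // eD; have := noD e eB; rewrite eD.
have endV e : e \in sE B -> exists2 y, y \in ends e & y \in sV B.
  move=> eB; have /set0Pn[y ye] : ends e != set0 by rewrite -card_gt0 F2.
  by exists y => //; apply: (subsetP (subgraph_ends eB)).
have [/exists_inP[u uI xW]|/exists_inPn xW] := boolP [exists u in I, x \in W u].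
  left; exists u => //; apply/esym; apply: Bmax.
  - apply/andP; split; first exact: subsetT.
    by apply/subsetP => e eX; rewrite inE; apply/orP; left; apply/bigcupP; exists u.
  - exact: Xnonsep.
  have hV y : y \in sV B -> y \in W u.
    move=> /hx; apply: (connect_inv (P := mem (W u))) => // a b /= aW /adjP[e eB Ee].
    have [u' uI' eX] := BX e eB; have := subsetP (X_ends uI' eX); rewrite Ee => hs.
    have aW' : a \in W u' by apply: hs; rewrite !inE eqxx.
    by rewrite (W_uniq uI uI' aW aW'); apply: hs; rewrite !inE eqxx orbT.
  apply/andP; split; first by rewrite WX //; apply/subsetP.
  apply/subsetP => e eB; have [u' uI' eX] := BX e eB.
  have [y ye /hV yW] := endV e eB.
  by rewrite /= (W_uniq uI uI' yW (subsetP (X_ends uI' eX) y ye)).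
(* Here [B] has at most the vertex [x], so it lies in the nonseparable subgraph of an edge of [D] at
   [x], and maximality applies. *)
have [e eD xe] := Dcover xW.
have hV y : y \in sV B -> y = x.
  move=> /hx hc; apply/eqP; apply: (connect_inv (P := pred1 x) _ _ hc); rewrite /= ?eqxx //.
  move=> a b /eqP-> /adjP[f fB Ef]; have [u uI fX] := BX f fB.
  case/negP: (xW u uI); apply: (subsetP (X_ends uI fX)).
  by rewrite Ef !inE eqxx.
have BK : sub_le B (induced [set e]).
  apply/andP; split; first by apply/subsetP => y /hV->; rewrite /= big_set1.
  apply/subsetP => f fB; have [u uI fX] := BX f fB.
  have [y yf /hV yx] := endV f fB; case/negP: (xW u uI).
  by rewrite -yx; apply: (subsetP (X_ends uI fX)).
have E : induced [set e] = B.
  apply: Bmax => //; last exact: edge_nonseparable (Dloop eD).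
  apply/andP; split; first exact: subsetT.
  by rewrite /= sub1set inE eD orbT.
by right; exists e.
Qed.

End Blocks.

(** * Minimal covers by contractible edges *)

Section MinimalCover.

Variable G : mgraph.

Definition cover_edges (S : {set vert G}) (D : {set edge G}) : bool :=
  [forall e in D, cedge e && (#|ends e| == 2)] &&
  [forall x, (x \in S) || [exists e in D, x \in ends e]].

Lemma minimal_cover (S : {set vert G}) : ~: S \subset ~: uncovered G ->
  exists D : {set edge G}, [/\ forall e, e \in D -> contractible e,
    forall e, e \in D -> #|ends e| = 2,
    forall x, x \notin S -> exists2 e, e \in D & x \in ends e &
    forall e, e \in D -> exists2 p, p \in ends e &
      p \notin S /\ forall f, f \in D -> p \in ends f -> f = e].
Proof.
move=> /subsetP hS.
have hall : cover_edges S [set e | cedge e && (#|ends e| == 2)].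
  apply/andP; split; first by apply/forall_inP => e; rewrite inE.
  apply/forallP => x; have [//|xS] := boolP (x \in S); apply/exists_inP.
  have := hS x; rewrite !in_setC => /(_ xS) /covered_edge[e /cedgeP he [h2 xe]].
  by exists e; rewrite // inE he h2.
have [D /minsetP[/andP[/forall_inP hD /forallP hcov] hmin] _] := minset_exists hall.
exists D; split.
- by move=> e /hD/andP[/cedgeP].
- by move=> e /hD/andP[_ /eqP].
- by move=> x xS; have := hcov x; rewrite (negPf xS) => /exists_inP.
move=> e eD.
have [/exists_inP[p pe /andP[pS /forall_inP hp]]|/exists_inPn hp] := boolP
    [exists p in ends e, (p \notin S) && [forall f in D, (p \in ends f) ==> (f == e)]].
  by exists p => //; split=> // f fD pf; apply/eqP; exact: implyP (hp f fD) pf.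
have E : D :\ e = D.
  apply: hmin; last exact: subsetDl.
  apply/andP; split; first by apply/forall_inP => f; rewrite in_setD1 => /andP[_ /hD].
  apply/forallP => x; have := hcov x; have [//|xS /exists_inP[f fD xf]] := boolP (x \in S).
  apply/exists_inP; have [fe|fe] := eqVneq f e; last by exists f; rewrite // in_setD1 fe.
  have := hp x; rewrite -{1}fe xf xS => /(_ isT); rewrite negb_forall_in.
  case/exists_inP => g gD; rewrite negb_imply => /andP[xg ge].
  by exists g; rewrite // in_setD1 ge.
by move: eD; rewrite -E in_setD1 eqxx.
Qed.

End MinimalCover.

Theorem corollary9 (G : mgraph) (hG : k_connected G 3) (hE : 0 < #|edge G|) :
  exists F : subgraph G,
    sV F = [set: vert G] /\
    forall B : subgraph G, block F B ->
      inner_fan B \/ exists2 e : edge G, contractible e & B = induced [set e].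
Proof.
have /card_gt0P[e0 _] := hE.
have /card_gt0P[x0 x0e] : 0 < #|ends e0| by case/andP: (ends_card e0).
(* On a single vertex every contraction has one vertex too, so the loop [e0] is contractible and is
   the only block of the subgraph chosen. *)
have [/forallP hV2|] := boolP [forall x : vert G, [exists y, y != x]]; last first.
  rewrite negb_forall => /existsP[x1]; rewrite negb_exists => /forallP h1.
  have E1 x : x = x1 by apply/eqP; have := h1 x; rewrite negbK.
  have EE x y : x = y :> vert G by rewrite (E1 x) (E1 y).
  have hF : [forall e in [set e0], ends e \subset [set: vert G]].
    by apply/forall_inP => e _; exact: subsetT.
  exists (Subgraph hF); split=> // B [BF _ Bmax]; right; exists e0.
    move=> S _; apply: connected_trivial => C C' _ _.
    have [x ->] := contract_projK C; have [y ->] := contract_projK C'.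
    by rewrite (EE x y).
  rewrite -(Bmax (Subgraph hF)) //.
  - apply: subgraph_eq => //=; rewrite big_set1; apply/setP => x.
    by rewrite (EE x x0) x0e inE.
  - by rewrite /sub_le !subxx.
  - split; first by apply: connected_trivial => x y _ _; exact: EE.
    move=> x; rewrite /cut_vertex negb_and negbK; apply/orP; right.
    by apply: connected_trivial => y z _ _; exact: EE.
have {}hV2 x : exists y : vert G, y != x by apply/existsP.
have [f hf] : exists f : vert G -> {set edge G} * {set vert G},
    forall u, u \in uncovered G -> hub_inner_fan u (f u).1 (f u).2.
  apply: (fin_all_exists (P := fun u XQ => u \in uncovered G -> hub_inner_fan u XQ.1 XQ.2)) => u.
  (* Covered vertices get a dummy pair. *)
  have [uU|uU] := boolP (u \in uncovered G); last by exists (set0, set0).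
  by have [XQ h] := uncovered_hub hG hV2 uU; exists XQ.
pose W u := u |: (f u).2.
have [|D [Dc D2 Dcov Dpriv]] := @minimal_cover G (\bigcup_(u in uncovered G) W u).
  rewrite setCS; apply/subsetP => u uU; apply/bigcupP; exists u => //.
  exact: setU11.
exists (spanning (uncovered G) (fun u => (f u).1) D); split=> // B hB.
have notW x : x \notin \bigcup_(u in uncovered G) W u <->
    (forall u, u \in uncovered G -> x \notin W u).
  split=> [h u uU|h]; first by apply: contra h => xW; apply/bigcupP; exists u.
  by apply/negP => /bigcupP[u uU]; apply/negP; exact: h.
case: (@spanning_block G (uncovered G) W (fun u => (f u).1) D _ _ _ _ _ _ _ B x0 hB).
- by move=> u uU; exact: hf_vert (hf u uU).
- by move=> u uU; exact: hf_nonsep (hf u uU).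
- by move=> u e uU; exact: hf_loop (hf u uU) e.
- by move=> u u' uU uU' uu'; apply: (hub_fans_disjoint hG hV2 uU uU' uu' (hf u uU) (hf u' uU')).
- exact: D2.
- by move=> x /notW; exact: Dcov.
- by move=> e /Dpriv[p pe [/notW pW hp]]; exists p.
- by move=> [u uU ->]; left; exact: hf_inner (hf u uU).
- by move=> [e eD ->]; right; exists e => //; exact: Dc.
Qed.
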